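(* Let $\mathbb K$ be a field of characteristic zero and let $A=A(V,L,R,\sigma)$. Consider the degree-lexicographical order on words in the generators $x_1,\dots,x_m,a,b,c$ determined by $x_1>x_2>\dots>x_m>c>b>a$. Then $A$ is automaton with respect to this order, i.e. the set of normal words of $A$ is a regular language.
   Context: Let $m\ge1$, $V$ an $m$-dimensional $\mathbb K$-vector space with basis $X=\{x_1,\dots,x_m\}$, $L,R\subseteq V$ subspaces, and $\sigma$ a linear endomorphism of $V$. The algebra $A(V,L,R,\sigma)$ is the associative $\mathbb K$-algebra generated by $Y=X\cup\{a,b,c\}$ (all of degree $1$; $V$ is identified with the span of $x_1,\dots,x_m$ in degree one of the free algebra) subject to the homogeneous quadratic relations: $x_ix_j$ for all $i,j$; $ya$ and $by$ for all $y\in Y$; $a\ell$ for all $\ell\in L$; $\rho b$ for all $\rho\in R$; and $x_ic-c\,\sigma(x_i)$ for $i=1,\dots,m$. A degree-lexicographical order compares words first by length, then lexicographically. A word is normal if it is not the leading word of any element of the two-sided ideal of relations. *)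

(* Defs.v *)
From HB Require Import structures.
From mathcomp Require Import all_boot all_order all_algebra.
Set Implicit Arguments. Unset Strict Implicit. Unset Printing Implicit Defensive.
Import GRing.Theory.
Local Open Scope ring_scope.

(* Generators Y = {x_0,...,x_{m-1}} ∪ {a,b,c}; GX i stands for x_{i+1}. *)
Inductive gen (m : nat) := GX of 'I_m | Ga | Gb | Gc.
Arguments Ga {m}. Arguments Gb {m}. Arguments Gc {m}.

Definition gen_enc m (y : gen m) : 'I_m + nat :=
  match y with GX i => inl i | Ga => inr 0%N | Gb => inr 1%N | Gc => inr 2%N end.
Definition gen_dec m (s : 'I_m + nat) : option (gen m) :=
  match s with
  | inl i => Some (GX i) | inr 0%N => Some Ga | inr 1%N => Some Gb
  | inr 2%N => Some Gc | _ => None end.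
Lemma gen_encK m : pcancel (@gen_enc m) (@gen_dec m).
Proof. by case. Qed.
HB.instance Definition _ m := Equality.copy (gen m) (pcan_type (@gen_encK m)).

Definition word m := seq (gen m).

Definition gen_rank m (y : gen m) : nat :=
  match y with
  | GX i => (3 + (m - 1 - i))%N | Gc => 2%N | Gb => 1%N | Ga => 0%N end.

Fixpoint lex_lt m (u v : word m) : bool :=
  match u, v with
  | [::], [::] => false
  | [::], _ :: _ => true
  | _ :: _, [::] => false
  | y :: u', z :: v' =>
      (gen_rank y < gen_rank z)%N || ((y == z) && lex_lt u' v')
  end.

Definition deglex_lt m (u v : word m) : bool :=
  (size u < size v)%N || ((size u == size v) && lex_lt u v).

(* Elements of the free algebra K<Y>: coefficient functions on words,
   with finite support. *)
Definition fpoly (K : fieldType) m := word m -> K.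
Definition fin_supp (K : fieldType) m (f : fpoly K m) : Prop :=
  exists s : seq (word m), forall w, w \notin s -> f w = 0.

Definition mono (K : fieldType) m (u : word m) : fpoly K m :=
  fun w => (w == u)%:R.
Definition padd (K : fieldType) m (f g : fpoly K m) : fpoly K m :=
  fun w => f w + g w.
Definition pscale (K : fieldType) m (c : K) (f : fpoly K m) : fpoly K m :=
  fun w => c * f w.
Definition pmul (K : fieldType) m (f g : fpoly K m) : fpoly K m :=
  fun w => \sum_(i < (size w).+1) f (take i w) * g (drop i w).

Definition vec_poly (K : fieldType) m (v : 'rV[K]_m) (pre post : word m)
  : fpoly K m :=
  fun w => \sum_(j < m) v 0 j * mono K (pre ++ GX j :: post) w.

(* Defining relations of A(V,L,R,sigma). L and R are subspaces of V = K^m,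
   given as row spaces of matrices; sigma acts on x_i by
   sigma(x_i) = sum_j sigma i j x_j. *)
Inductive rel_A (K : fieldType) m (L R sigma : 'M[K]_m) : fpoly K m -> Prop :=
  | rel_xx (i j : 'I_m) : rel_A L R sigma (mono K [:: GX i; GX j])
  | rel_ya (y : gen m) : rel_A L R sigma (mono K [:: y; Ga])
  | rel_by (y : gen m) : rel_A L R sigma (mono K [:: Gb; y])
  | rel_aL (l : 'rV[K]_m) : (l <= L)%MS -> rel_A L R sigma (vec_poly l [:: Ga] [::])
  | rel_Rb (r : 'rV[K]_m) : (r <= R)%MS -> rel_A L R sigma (vec_poly r [::] [:: Gb])
  | rel_xc (i : 'I_m) :
      rel_A L R sigma (padd (mono K [:: GX i; Gc])
                             (pscale (-1) (vec_poly (row i sigma) [:: Gc] [::]))).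

Definition in_ideal (K : fieldType) m (L R sigma : 'M[K]_m) (f : fpoly K m) : Prop :=
  exists (n : nat) (c : 'I_n -> K) (u v : 'I_n -> word m) (r : 'I_n -> fpoly K m),
    (forall k, rel_A L R sigma (r k)) /\
    forall w, f w = \sum_(k < n) c k *
                     pmul (pmul (mono K (u k)) (r k)) (mono K (v k)) w.

Definition leading_word (K : fieldType) m (f : fpoly K m) (w : word m) : Prop :=
  f w != 0 /\ forall w', f w' != 0 -> (w' == w) || deglex_lt w' w.

Definition normal_word (K : fieldType) m (L R sigma : 'M[K]_m) (w : word m) : Prop :=
  ~ exists f, in_ideal L R sigma f /\ leading_word f w.

Definition regular_language (A : Type) (P : seq A -> Prop) : Prop :=
  exists (Q : finType) (q0 : Q) (delta : Q -> A -> Q) (F : pred Q),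
    forall w, P w <-> foldl delta q0 w \in F.

(* Main.v *)
Require Import Defs.
From HB Require Import structures.
From mathcomp Require Import all_boot all_order all_algebra.
From mathcomp Require Import boolp.
From mathcomp Require Import zify ring.
Set Implicit Arguments. Unset Strict Implicit. Unset Printing Implicit Defensive.
Import Order.TTheory GRing.Theory Num.Theory.
Local Open Scope ring_scope.

(** Modulo the monomial relations and x c -> c sigma(x), every word is zero or
    one of [a] c^n [b] and [a] c^n x_j [b]. The first kind is always normal; the
    second is normal iff j is not the leading index of a vector of
    U_n = L sigma^n + R, where L (resp. R) is present only together with the
    letter a (resp. b). So the language is regular as soon as, for fixed j, the
    set of n such that j is a leading index of U_n is eventually periodic. This
    is a condition on the ranks of matrices whose minors are linear recurrent
    sequences in n, and the Skolem-Mahler-Lech theorem applies.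

    Skolem-Mahler-Lech is proved after Hansel. If A = 1 mod p^2 over the
    localisation Z_(p), then u A^n v is a sum of C(n, k) p^(2k) d_k with d_k
    p-integral, and infinitely many zeros force it to vanish. In general some
    power A^N is 1 mod p^2 by pigeonhole. An arbitrary field of characteristic
    zero is reached by homomorphisms from a finitely generated subring to matrix
    rings over Z_(p): transcendental generators are sent to integers, and
    algebraic ones act on a free module by multiplication. The prime p and the
    matrix size, hence N, can be chosen independently of the element that the
    homomorphism must not kill, and this makes the period uniform. *)

(** * p-integral rationals *)

Definition Zloc (p : nat) : {pred rat} :=
  fun x => `[< exists2 m : nat, coprime p m & x * m%:R \is a Num.int >].

Lemma ZlocP p x :
  reflect (exists2 m : nat, coprime p m & x * m%:R \is a Num.int) (x \in Zloc p).
Proof. exact: asboolP. Qed.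

Lemma Zloc_subring p : subring_closed (Zloc p).
Proof.
split=> [|x y /ZlocP[m pm xm] /ZlocP[n pn yn]|x y /ZlocP[m pm xm] /ZlocP[n pn yn]].
- by apply/ZlocP; exists 1%N; rewrite ?coprimen1 // mul1r.
- apply/ZlocP; exists (m * n)%N; first by rewrite coprimeMr pm.
  rewrite natrM mulrBl mulrA [y * _]mulrCA rpredB // rpredM //; exact: Num.Theory.natr_int.
- apply/ZlocP; exists (m * n)%N; first by rewrite coprimeMr pm.
  by rewrite natrM mulrACA rpredM.
Qed.
HB.instance Definition _ p := GRing.isSubringClosed.Build rat (Zloc p) (Zloc_subring p).

Lemma Zloc_inv_nat p m : coprime p m -> (m%:R)^-1 \in Zloc p.
Proof.
move=> pm; apply/ZlocP; exists m => //.
have [->|m0] := eqVneq m 0%N; first by rewrite mulr0 rpred0.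
by rewrite mulVf ?rpred1 // pnatr_eq0.
Qed.

(** Units of the local ring Z_(p) are stable under multiples of p: x + p z = x (1 + p z h), and if z
    h = a / m then the second factor is (m + p a) / m, whose numerator is still prime to p. *)
Lemma Zloc_local p x h z : prime p -> x \in Zloc p -> h \in Zloc p -> x * h = 1 ->
  z \in Zloc p -> exists2 h', h' \in Zloc p & (x + p%:R * z) * h' = 1.
Proof.
move=> pp xO hO xh zO.
have x0 : x != 0 by apply/eqP=> x0; move/eqP: xh; rewrite x0 mul0r eq_sym oner_eq0.
have /ZlocP[m pm] : z * h \in Zloc p by rewrite rpredM.
case/intrP=> a ea.
have m0 : m != 0%N.
  by apply/eqP=> m0; move: pm; rewrite m0 /coprime gcdn0; move: (prime_gt1 pp); lia.
pose N : int := m%:Z + p%:Z * a.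
have pN : coprime p `|N|%N.
  rewrite prime_coprime //; apply/negP=> pN.
  have : (p%:Z %| m%:Z)%Z.
    have -> : m%:Z = N - p%:Z * a by rewrite /N addrK.
    by rewrite rpredB ?dvdz_mulr //.
  by move: pm; rewrite prime_coprime // => /negP pm' /pm'.
have N0 : N != 0.
  by apply/eqP=> N0; move: pN; rewrite N0 /coprime gcdn0; move: (prime_gt1 pp); lia.
have inN : (N%:~R : rat)^-1 \in Zloc p.
  have -> : (N%:~R : rat) = (-1) ^+ (N < 0)%R * `|N|%N%:R.
    by rewrite {1}[N]intEsign rmorphM /= rmorphXn /= rmorphN1.
  rewrite invfM rpredM ?Zloc_inv_nat // invr_sign.
  by rewrite rpredX // rpredN1.
exists (h * m%:R / N%:~R); first by rewrite !rpredM // rpred_nat.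
have e1 : x + p%:R * z = x * (N%:~R / m%:R).
  have -> : N%:~R = m%:R + p%:R * (z * h * m%:R) :> rat.
    by rewrite ea /N rmorphD rmorphM.
  rewrite mulrDl divff ?pnatr_eq0 // !mulrA mulfK ?pnatr_eq0 //.
  by rewrite mulrDr mulr1; congr (_ + _); transitivity (p%:R * z * (x * h)); [rewrite xh mulr1|ring].
have N0' : N%:~R != 0 :> rat by rewrite intr_eq0.
have m0' : m%:R != 0 :> rat by rewrite pnatr_eq0.
by rewrite e1 -[RHS]xh; field; rewrite N0' m0'.
Qed.

(** The ideal p^e Z_(p), as a subset of the rationals. *)
Definition pZloc (p e : nat) : {pred rat} := fun x => x / p%:R ^+ e \in Zloc p.

Lemma pZlocE p e x : (x \in pZloc p e) = (x / p%:R ^+ e \in Zloc p).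
Proof. by []. Qed.

Lemma pZloc_zmod p e : zmod_closed (pZloc p e).
Proof.
split=> [|x y]; first by rewrite pZlocE mul0r rpred0.
by rewrite !pZlocE => xO yO; rewrite mulrBl rpredB.
Qed.
HB.instance Definition _ p e := GRing.isZmodClosed.Build rat (pZloc p e) (pZloc_zmod p e).

Lemma pZlocM p e x y : x \in Zloc p -> y \in pZloc p e -> x * y \in pZloc p e.
Proof. by rewrite !pZlocE => xO yO; rewrite -mulrA; exact: rpredM. Qed.

Lemma pZloc_le p e e' x : prime p -> (e' <= e)%N -> x \in pZloc p e -> x \in pZloc p e'.
Proof.
move=> pp le; rewrite !pZlocE => xO.
have p0 : p%:R != 0 :> rat by rewrite pnatr_eq0; move: (prime_gt0 pp); lia.
have -> : x / p%:R ^+ e' = x / p%:R ^+ e * p%:R ^+ (e - e').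
  have -> : p%:R ^+ e = p%:R ^+ (e - e') * p%:R ^+ e' :> rat by rewrite -exprD subnK.
  by field; rewrite !expf_neq0.
by rewrite rpredM // rpredX // rpred_nat.
Qed.

Lemma pZloc_separated p x : prime p -> (forall e, x \in pZloc p e) -> x = 0.
Proof.
move=> pp xO; apply/eqP/negPn/negP => x0.
have a0 : (0 < `|numq x|)%N by rewrite absz_gt0 numq_eq0.
have p0 : p%:R != 0 :> rat by rewrite pnatr_eq0; move: (prime_gt0 pp); lia.
(* This exponent suffices: p^e would divide the nonzero numerator, of absolute value e < p^e. *)
pose e := `|numq x|%N.
move: (xO e); rewrite pZlocE => /ZlocP[m pm /intrP[z ez]].
have : (p ^ e %| `|numq x| * m)%N.
  apply/dvdnP; exists (absz (z * denq x)%R).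
  rewrite -[m]/(absz m%:Z) -[(p ^ e)%N]/(absz (p ^ e)%:Z) -!abszM; congr absz.
  apply: (@intr_inj rat); rewrite !rmorphM /= -ez numqE -!pmulrn natrX.
  by field; rewrite expf_neq0.
rewrite Gauss_dvdl ?coprimeXl // => /(dvdn_leq a0).
by rewrite leqNgt ltn_expl // prime_gt1.
Qed.

Lemma logn_fact_le p n : prime p -> (logn p n`! <= n)%N.
Proof.
move=> pp; rewrite logn_fact //.
have p1 := prime_gt1 pp.
(* In Legendre's sum each quotient is at most half of the previous one, so the partial sum plus one
   more copy of the last quotient never exceeds n. *)
have H : forall k, (\sum_(1 <= i < k.+1) n %/ p ^ i + n %/ p ^ k <= n)%N.
  elim=> [|k IH]; first by rewrite big_nil expn0 divn1.
  rewrite big_nat_recr //=; apply: leq_trans IH.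
  rewrite -addnA leq_add2l expnSr divnMA addnn -muln2.
  by apply: leq_trans (leq_trunc_div _ p); rewrite leq_mul.
by apply: leq_trans (H n); exact: leq_addr.
Qed.

Lemma Zloc_expn_fact p n : prime p -> p%:R ^+ n / (n`!)%:R \in Zloc p.
Proof.
move=> pp; have p0 : p%:R != 0 :> rat by rewrite pnatr_eq0; move: (prime_gt0 pp); lia.
have [m pm e] := pfactor_coprime pp (fact_gt0 n).
have := logn_fact_le n pp; move: (logn p n`!) e => l e le.
have m0 : m%:R != 0 :> rat.
  by apply/eqP=> m0; move: (fact_gt0 n); rewrite e -(@ltr_nat rat) natrM m0 mul0r ltxx.
have -> : p%:R ^+ n / (n`!)%:R = p%:R ^+ (n - l) / m%:R :> rat.
  have -> : p%:R ^+ n = p%:R ^+ (n - l) * p%:R ^+ l :> rat by rewrite -exprD subnK.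
  by rewrite e natrM natrX; field; rewrite m0 expf_neq0.
by rewrite rpredM ?Zloc_inv_nat // rpredX // rpred_nat.
Qed.

(** Comparing coefficients gives Q_i = P_(i+1) + t Q_(i+1), so divisibility descends from the top;
    each root removed gains one coefficient. *)
Lemma quotient_XsubC_pZloc p e (P Q : {poly rat}) t k : t \in Zloc p ->
  P = Q * ('X - t%:P) -> (forall i, (k < i)%N -> P`_i \in pZloc p e) ->
  forall i, (k <= i)%N -> Q`_i \in pZloc p e.
Proof.
move=> tO PQ PO i; move eqn : (size Q - i)%N => n.
elim: n i eqn => [|n IH] i eqn ki; first by rewrite nth_default ?rpred0 // -subn_eq0 eqn.
have -> : Q`_i = P`_i.+1 + t * Q`_i.+1.
  by rewrite PQ mulrBr coefB coefMX /= coefMC [t * _]mulrC subrK.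
by rewrite rpredD ?PO // pZlocM // IH ?subnS ?eqn ?leqW.
Qed.

Lemma quotient_roots_pZloc p e (ts : seq rat) (P Q : {poly rat}) :
  all (mem (Zloc p)) ts -> P = Q * \prod_(t <- ts) ('X - t%:P) ->
  (forall i, (size ts <= i)%N -> P`_i \in pZloc p e) ->
  forall i, Q`_i \in pZloc p e.
Proof.
elim: ts P => [|t ts IH] P /=; first by move=> _; rewrite big_nil mulr1 => -> H i; exact: H.
case/andP=> tO tsO; rewrite big_cons mulrCA mulrC => PQ PO.
apply: (IH (Q * \prod_(t <- ts) ('X - t%:P))) => //.
exact: (quotient_XsubC_pZloc tO PQ).
Qed.

(** The falling factorial X (X - 1) ... (X - k + 1); divided by k! it makes C(n, k) a polynomial in
    n. *)
Definition ffact_poly (k : nat) : {poly rat} := \prod_(i < k) ('X - (i%:R)%:P).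

Lemma ffact_poly_over p k : ffact_poly k \is a polyOver (Zloc p).
Proof. by apply: rpred_prod => i _; rewrite polyOverXsubC rpred_nat. Qed.

Lemma coef_ffact_poly k i : (k < i)%N -> (ffact_poly k)`_i = 0.
Proof. by move=> ki; rewrite nth_default // size_prod_XsubC /index_enum -enumT size_enum_ord. Qed.

Lemma horner_ffact_poly k n : (ffact_poly k).[n%:R] = ('C(n, k) * k`!)%:R.
Proof.
rewrite bin_ffact /ffact_poly horner_prod; elim: k => [|k IH].
  by rewrite big_ord0 ffactn0.
rewrite big_ord_recr /= IH hornerXsubC ffactnSr natrM.
case: (leqP k n) => kn; first by rewrite natrB.
by rewrite ffact_small // !mul0r.
Qed.

(* The truncations of the series are polynomials whose coefficient of X^i is
   divisible by p^i; dividing out e roots therefore leaves a quotient, and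
   hence values, divisible by p^e. *)
Lemma infinitely_many_zeros_eq0 p (d : nat -> rat) : prime p ->
  (forall k, d k \in Zloc p) ->
  let f n := \sum_(k < n.+1) d k * (p ^ (2 * k) * 'C(n, k))%:R in
  (forall M, exists2 n, (M <= n)%N & f n = 0) -> forall n, f n = 0.
Proof.
move=> pp dO f inf n; apply: (pZloc_separated pp) => e.
have [ts [sz us zs]] : exists ts : seq nat, [/\ size ts = e, uniq ts & forall t, t \in ts -> f t = 0].
  elim: {n} e => [|e [ts [sz us zs]]]; first by exists [::].
  have [n nM fn] := inf (\max_(t <- ts) t).+1.
  exists (n :: ts); split=> /=; first by rewrite sz.
    rewrite us andbT; apply/negP=> nts.
    by move: nM; rewrite ltnNge (@leq_bigmax_seq _ ts xpredT id n).
  by move=> t; rewrite inE => /orP[/eqP->|/zs].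
(* M bounds n and all chosen zeros. At these points the truncation P agrees with f, because C(j, k)
   = 0 for k > j. *)
pose M := (n + \max_(t <- ts) t)%N.
pose P : {poly rat} := \sum_(k < M.+1) (d k * (p%:R ^+ (2 * k) / (k`!)%:R)) *: ffact_poly k.
have P_f : forall j, (j <= M)%N -> P.[j%:R] = f j.
  move=> j jM; rewrite /P horner_sum.
  rewrite (eq_bigr (fun k : 'I_M.+1 => d k * (p ^ (2 * k) * 'C(j, k))%:R)); last first.
    move=> k _; rewrite hornerZ horner_ffact_poly !natrM natrX.
    rewrite -!mulrA; congr (_ * _); congr (_ * _).
    by rewrite mulrCA mulVf ?mulr1 // pnatr_eq0; move: (fact_gt0 k); lia.
  rewrite /f -!(big_mkord xpredT (fun k => d k * (p ^ (2 * k) * 'C(j, k))%:R)).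
  rewrite (@big_cat_nat _ _ _ j.+1) //= [X in _ + X]big_nat_cond [X in _ + X]big1 ?addr0 //.
  by move=> i /andP[/andP[ji _] _]; rewrite bin_small // muln0 mulr0.
(* Only terms with k >= i reach X^i, and p^(2k) / k! lies in p^k Z_(p) because p^k / k! is
   p-integral. *)
have P_coef : forall i, P`_i \in pZloc p i.
  move=> i; rewrite coef_sum rpred_sum // => k _; rewrite coefZ.
  case: (leqP i k) => [ik|ki]; last by rewrite coef_ffact_poly // mulr0 rpred0.
  rewrite mulrC pZlocM //; first by have /polyOverP := ffact_poly_over p k; exact.
  rewrite pZlocM //; apply: (pZloc_le pp ik).
  have p0 : p%:R != 0 :> rat by rewrite pnatr_eq0; move: (prime_gt0 pp); lia.
  have k0 : (k`!)%:R != 0 :> rat by rewrite pnatr_eq0 -lt0n fact_gt0.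
  have e' : p%:R ^+ (2 * k) / (k`!)%:R / p%:R ^+ k = p%:R ^+ k / (k`!)%:R :> rat.
    by rewrite mul2n -addnn exprD; field; rewrite k0 expf_neq0.
  by rewrite pZlocE e' Zloc_expn_fact.
pose rs : seq rat := [seq t%:R | t <- ts].
have rsP : all (root P) rs.
  apply/allP=> _ /mapP[t tts ->]; rewrite /root P_f ?zs //.
  by apply: leq_trans (leq_addl _ _); exact: (@leq_bigmax_seq _ ts xpredT id t).
have rsU : uniq_roots rs.
  rewrite uniq_rootsE map_inj_uniq // => a b /eqP; rewrite eqr_nat; exact/eqP.
have [Q PQ] := uniq_roots_prod_XsubC rsP rsU.
have Q_coef : forall i, Q`_i \in pZloc p e.
  apply: (quotient_roots_pZloc _ PQ).
    by apply/allP=> _ /mapP[t _ ->]; rewrite inE rpred_nat.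
  by move=> i; rewrite size_map sz => ei; exact: (pZloc_le pp ei).
rewrite -P_f ?leq_addr // PQ hornerM mulrC pZlocM //.
  rewrite horner_prod big_map rpred_prod // => t _; rewrite hornerXsubC.
  by rewrite rpredB // rpred_nat.
rewrite horner_coef rpred_sum // => i _; rewrite mulrC pZlocM //.
by rewrite rpredX // rpred_nat.
Qed.

(** * Orders over the p-integral rationals *)

Lemma additive_of (U V : zmodType) (f : U -> V) :
  {morph f : x y / x - y} -> exists g : {additive U -> V}, g =1 f.
Proof.
move=> fB.
exists (HB.pack_for {additive U -> V} f (GRing.isZmodMorphism.Build U V f fB)).
by [].
Qed.

(* Pairs (T, T0) that behave like matrices over Q and over Z_(p): T0/p^2 T0 is
   finite, with classes labelled by R, and p-integral functionals separate T. *)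
Record porder (p : nat) (R : finType) (T : pzRingType) (T0 : {pred T}) : Prop := {
  porder_residue : exists red : T -> R, forall x y, x \in T0 -> y \in T0 ->
    red x = red y -> exists2 z, z \in T0 & x - y = z *+ (p ^ 2);
  porder_separated : forall t, t != 0 -> exists lam : {additive T -> rat},
    (forall x, x \in T0 -> lam x \in Zloc p) /\ lam t != 0 }.

Lemma porder_matrix p (R : finType) (T : pzRingType) (T0 : {pred T}) n :
  porder p R T0 ->
  porder p {ffun 'I_n * 'I_n -> R} (mxOver_pred T0 : {pred 'M[T]_n}).
Proof.
case=> [[red redP] sepT]; split.
  exists (fun M : 'M[T]_n => [ffun ij => red (M ij.1 ij.2)]) => M N /mxOverP MT /mxOverP NT /ffunP e.
  have H : forall ij : 'I_n * 'I_n, exists z, z \in T0 /\ M ij.1 ij.2 - N ij.1 ij.2 = z *+ (p ^ 2).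
    by case=> i j; have := e (i, j); rewrite !ffunE => /(redP _ _ (MT _ _) (NT _ _))[z ? ?]; exists z.
  have [z zP] := choice H.
  exists (\matrix_(i, j) z (i, j)).
    by apply/mxOverP => i j; rewrite mxE; case: (zP (i, j)).
  apply/matrixP=> i j; rewrite mulmxnE !mxE; exact: (zP (i, j)).2.
move=> M M0.
have [i [j Mij]] : exists i j, M i j != 0.
  apply: contrapT => H; case/eqP: M0; apply/matrixP=> i j; rewrite mxE.
  by apply/eqP/negPn/negP => Mij; apply: H; exists i, j.
have [lam [lamO lamM]] := sepT _ Mij.
have [g gE] : exists g : {additive 'M[T]_n -> rat}, g =1 (fun N => lam (N i j)).
  by apply: additive_of => X Y; rewrite !mxE raddfB.
by exists g; split=> [X /mxOverP XT|]; rewrite gE // lamO.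
Qed.

Lemma expr_unipotent_mod (T : pzRingType) (T0 : subringClosed T) q (c : T) t : c \in T0 ->
  exists2 b, b \in T0 & (1 + c *+ q) ^+ t = 1 + b *+ q.
Proof.
move=> cT; elim: t => [|t [b bT e]]; first by exists 0; rewrite ?rpred0 // mul0rn addr0.
exists (b + c + (c * b) *+ q); first by rewrite !(rpredD, rpredM, rpredMn).
rewrite exprS e mulrDl mul1r mulrDr mulr1 mulrnAl mulrnAr -!addrA; congr (_ + _).
by rewrite !mulrnDl.
Qed.

(** By pigeonhole two of the powers x^0, ..., x^|R| have the same label. Cancelling the smaller one
    with the right inverse h gives x^d = 1 mod p^2 for some 1 <= d <= |R|, and d divides |R|!, an
    exponent that depends on R alone. *)
Lemma porder_unipotent_power p (R : finType) (T : pzRingType) (T0 : subringClosed T) x h :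
  porder p R T0 -> x \in T0 -> h \in T0 -> x * h = 1 ->
  exists2 b, b \in T0 & x ^+ (#|R|`!) = 1 + b *+ (p ^ 2).
Proof.
case=> [[red redP] _] xT hT xh.
pose F (i : 'I_(#|R|.+1)) := red (x ^+ i).
have : ~~ injectiveb F.
  apply/negP=> /injectiveP /leq_card; by rewrite card_ord ltnn.
case/injectivePn => i [j ij Fij].
wlog lt_ij : i j ij Fij / (i < j)%N.
  move=> H; case: (ltngtP i j) => ij'; [exact: (H i j)| |by case/eqP: ij; apply: val_inj].
  by apply: (H j i) => //; rewrite eq_sym.
have [z zT ez] := redP _ _ (rpredX j xT) (rpredX i xT) (esym Fij).
have xihi : forall k, x ^+ k * h ^+ k = 1.
  elim=> [|k IH]; first by rewrite !expr0 mulr1.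
  by rewrite exprSr exprS mulrA -[x ^+ k * x * h]mulrA xh mulr1.
have e : x ^+ (j - i) = 1 + (z * h ^+ i) *+ p ^ 2.
  apply/eqP; rewrite addrC -subr_eq; apply/eqP.
  have := congr1 (fun y => y * h ^+ i) ez; rewrite mulrBl xihi mulrnAl => <-.
  by rewrite -[in RHS](subnK (ltnW lt_ij)) exprD -mulrA xihi mulr1.
have zhT : z * h ^+ i \in T0 by rewrite rpredM // rpredX.
have /dvdnP[t ->] : (j - i %| #|R|`!)%N.
  by apply: dvdn_fact; have := ltn_ord j; lia.
by rewrite mulnC exprM e; exact: expr_unipotent_mod.
Qed.

(** The binomial expansion of (1 + p^2 b)^n gives the series of [infinitely_many_zeros_eq0] with d_k
    = lam(y b^k). *)
Lemma porder_zeros p (T : pzRingType) (T0 : subringClosed T) (lam : {additive T -> rat}) N x y b :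
  prime p -> (forall z, z \in T0 -> lam z \in Zloc p) -> y \in T0 -> b \in T0 ->
  x ^+ N = 1 + b *+ (p ^ 2) ->
  (forall M, exists2 n, (M <= n)%N & lam (y * x ^+ (N * n)) = 0) ->
  forall n, lam (y * x ^+ (N * n)) = 0.
Proof.
move=> pp lamO yT bT xN.
have E : forall n, lam (y * x ^+ (N * n)) =
    \sum_(k < n.+1) lam (y * b ^+ k) * (p ^ (2 * k) * 'C(n, k))%:R.
  move=> n; rewrite exprM xN [1 + _]addrC exprD1n mulr_sumr raddf_sum.
  apply: eq_bigr => k _; rewrite mulr_natr exprMn_n -mulrnA -expnM mulrnAr raddfMn.
  by [].
move=> inf n; rewrite E; move: n.
apply: (infinitely_many_zeros_eq0 pp (d := fun k => lam (y * b ^+ k))).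
  by move=> k; rewrite lamO // rpredM // rpredX.
by move=> M; have [n nM] := inf M; rewrite E; exists n.
Qed.

Definition mxOver_subring (T : pzRingType) (T0 : subringClosed T) n : subringClosed 'M[T]_n :=
  GRing.SubringClosed.clone _ (@mxOver_pred n n T T0) _.

Lemma mxOverX (T : pzRingType) (T0 : subringClosed T) n (A : 'M[T]_n) k :
  A \is a mxOver T0 -> A ^+ k \is a mxOver T0.
Proof.
move=> AT; elim: k => [|k IH]; first by rewrite expr0 mxOver_scalar ?rpred0 ?rpred1.
by rewrite exprS -mulmxE mxOverM.
Qed.

(** * Specialisation homomorphisms on subrings of a field *)

Record hom_on (K T : pzRingType) (S : {pred K}) (T0 : {pred T}) (phi : K -> T) : Prop := {
  hom_on1 : phi 1 = 1;
  hom_onB : {in S &, {morph phi : x y / x - y}};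
  hom_onM : {in S &, {morph phi : x y / x * y}};
  hom_on_in : forall x, x \in S -> phi x \in T0 }.

Section HomOn.
Variables (K T : pzRingType) (S : subringClosed K) (T0 : subringClosed T) (phi : K -> T).
Hypothesis hphi : hom_on S T0 phi.

Lemma hom_on0 : phi 0 = 0.
Proof. by rewrite -{1}(subrr 0) (hom_onB hphi) ?rpred0 // subrr. Qed.

Lemma hom_onD : {in S &, {morph phi : x y / x + y}}.
Proof.
move=> x y xS yS.
rewrite -{1}[y]opprK (hom_onB hphi) ?rpredN // -[- y]sub0r (hom_onB hphi) ?rpred0 //.
by rewrite hom_on0 sub0r opprK.
Qed.

Lemma hom_on_sum I r (P : pred I) F : (forall i, P i -> F i \in S) ->
  phi (\sum_(i <- r | P i) F i) = \sum_(i <- r | P i) phi (F i).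
Proof.
move=> FS.
suff [] : \sum_(i <- r | P i) F i \in S /\
  phi (\sum_(i <- r | P i) F i) = \sum_(i <- r | P i) phi (F i) by [].
apply: (big_rec2 (fun a b => a \in S /\ phi a = b)) => [|i a b Pi [aS e]].
  by rewrite rpred0 hom_on0.
by rewrite rpredD ?FS // hom_onD ?FS // e.
Qed.

Lemma hom_on_nat n : phi n%:R = n%:R.
Proof.
elim: n => [|n IH]; first by rewrite hom_on0.
by rewrite -[n.+1]addn1 !natrD hom_onD ?rpred_nat // IH (hom_on1 hphi).
Qed.

Lemma hom_on_mulmx m n k (A : 'M[K]_(m, n)) (B : 'M[K]_(n, k)) :
  A \is a mxOver S -> B \is a mxOver S ->
  map_mx phi (A *m B) = map_mx phi A *m map_mx phi B.
Proof.
move=> /mxOverP AS /mxOverP BS; apply/matrixP=> i j; rewrite !mxE hom_on_sum.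
  by apply: eq_bigr => l _; rewrite !mxE (hom_onM hphi).
by move=> l _; rewrite rpredM.
Qed.

Lemma hom_on_scalar_mx n (a : K) : map_mx phi (a%:M : 'M_n) = (phi a)%:M.
Proof. by apply/matrixP=> i j; rewrite !mxE; case: eqP => // _; rewrite hom_on0. Qed.

Lemma hom_on_mxOver m n (A : 'M[K]_(m, n)) :
  A \is a mxOver S -> map_mx phi A \is a mxOver T0.
Proof. by move=> /mxOverP AS; apply/mxOverP=> i j; rewrite mxE (hom_on_in hphi). Qed.

Lemma hom_on_expmx n (A : 'M[K]_n) k :
  A \is a mxOver S -> map_mx phi (A ^+ k) = map_mx phi A ^+ k.
Proof.
move=> AS; elim: k => [|k IH].
  by rewrite !expr0 -![1]/(1%:M) hom_on_scalar_mx (hom_on1 hphi).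
by rewrite !exprS -!mulmxE hom_on_mulmx ?IH // mxOverX.
Qed.
End HomOn.

(* p and the residue labels R depend on g only, not on x. *)
Definition good_subring (K : fieldType) (S : {pred K}) : Prop :=
  forall g, g \in S -> g != 0 -> exists (p : nat) (R : finType), prime p /\
    forall x, x \in S -> x != 0 ->
    exists (T : pzRingType) (T0 : subringClosed T) (phi : K -> T),
      [/\ porder p R T0, hom_on S T0 phi, phi x != 0 &
          exists2 h, h \in T0 & phi g * h = 1].

Lemma mxOver_adj (K : comNzRingType) (S : subringClosed K) n (A : 'M[K]_n) :
  A \is a mxOver S -> \det A \in S /\ \adj A \is a mxOver S.
Proof.
have detS : forall n (B : 'M[K]_n), B \is a mxOver S -> \det B \in S.
  move=> k B /mxOverP BS; rewrite rpred_sum // => s _.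
  by rewrite rpredM ?rpredX ?rpredN1 // rpred_prod.
move=> AS; split; first exact: detS.
apply/mxOverP=> i j; rewrite mxE rpredM ?rpredX ?rpredN1 // detS //.
by apply/mxOverP => k l; rewrite !mxE (mxOverP AS).
Qed.

(** A nonzero term at n would stay nonzero under some phi that makes [\det A], hence A, invertible,
    while [porder_zeros] forces its image to vanish. N depends only on m and on the labels chosen
    for [\det A], so it serves every r. *)
Lemma good_subring_zeros (K : fieldType) (S : subringClosed K) m
    (A : 'M[K]_m) (u : 'rV_m) (v : 'cV_m) :
  good_subring S -> A \is a mxOver S -> u \is a mxOver S -> v \is a mxOver S ->
  \det A != 0 ->
  exists2 N, (0 < N)%N & forall r,
    (forall M, exists2 n, (M <= n)%N & (u *m A ^+ (r + N * n) *m v) 0 0 = 0) ->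
    forall n, (u *m A ^+ (r + N * n) *m v) 0 0 = 0.
Proof.
move=> gS AS uS vS detA.
have [dS adjS] := mxOver_adj AS.
have [p [R [pp H]]] := gS _ dS detA.
pose E := {ffun 'I_m * 'I_m -> R}.
exists #|E|`!; first exact: fact_gt0.
set N := #|E|`! => r inf n; apply/eqP/negPn/negP => xn0.
have xS k : (u *m A ^+ k *m v) 0 0 \in S.
  by have /mxOverP := mxOverM (mxOverM uS (mxOverX k AS)) vS; apply.
have [T [T0 [phi [poT hphi phix [h hT gh]]]]] := H _ (xS _) xn0.
have [_ /(_ _ phix)[lam [lamO lamx]]] := poT.
pose X := map_mx phi A; pose U := map_mx phi u; pose W := map_mx phi v.
have phiE k : phi ((u *m A ^+ k *m v) 0 0) = (U *m X ^+ k *m W) 0 0.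
  rewrite -(hom_on_expmx hphi) // -(hom_on_mulmx hphi) ?mxOverX //.
  rewrite -(hom_on_mulmx hphi) //; [by rewrite [RHS]mxE|by apply: mxOverM => //; exact: mxOverX].
have XT : X \is a mxOver T0 by apply: (hom_on_mxOver hphi).
have HX : X * (map_mx phi (\adj A) *m h%:M) = 1.
  rewrite -mulmxE mulmxA /X -(hom_on_mulmx hphi) // mul_mx_adj (hom_on_scalar_mx hphi).
  by rewrite -scalar_mxM gh.
have HT : map_mx phi (\adj A) *m h%:M \is a mxOver T0.
  by rewrite mxOverM ?(hom_on_mxOver hphi) // mxOver_scalar ?rpred0.
have [b bT XN] := porder_unipotent_power (T0 := mxOver_subring T0 m) (porder_matrix m poT) XT HT HX.
have [mu muE] : exists mu : {additive 'M[T]_m -> rat}, mu =1 (fun Y => lam ((U *m Y *m W) 0 0)).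
  by apply: additive_of => Y Z; rewrite mulmxBr mulmxBl !mxE raddfB.
case/negP: lamx; rewrite phiE exprD -(muE (_ * _)).
have UT : U \is a mxOver T0 by apply: (hom_on_mxOver hphi).
have WT : W \is a mxOver T0 by apply: (hom_on_mxOver hphi).
apply/eqP; move: n {xn0 phix}; apply: (porder_zeros (T0 := mxOver_subring T0 m) pp _ _ bT XN).
- move=> Y YT; rewrite muE lamO //.
  by have /mxOverP := mxOverM (mxOverM UT YT) WT; apply.
- by rewrite mxOverX.
move=> M; have [n nM e] := inf M; exists n => //.
by rewrite muE -exprD -phiE e (hom_on0 hphi) raddf0.
Qed.

(** * Transcendental extensions *)

(** Z_(p) and Z have the same residues mod q = p^2: if x m = a and u m + v q = 1, then x = a u + q
    (x v), and the integer a u is reduced mod q. *)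
Lemma Zloc_residue p x : prime p -> x \in Zloc p ->
  exists k : 'I_(p ^ 2), exists2 z, z \in Zloc p & x - k%:R = z *+ (p ^ 2).
Proof.
move=> pp xO; have := xO => /ZlocP[m pm /intrP[a ea]].
have mq : coprime m (p ^ 2) by rewrite coprimeXr // coprime_sym.
have : (0 < p ^ 2)%N by rewrite expn_gt0 prime_gt0.
move: (p ^ 2)%N mq => q mq q0.
have [u [v uv]] := Bezoutz m%:Z q%:Z.
have {}uv : u * m%:Z + v * q%:Z = 1.
  by rewrite uv /gcdz /= (eqP mq).
pose r := ((a * u) %% q%:Z)%Z.
have r0 : 0 <= r by rewrite modz_ge0 //; lia.
have rq : (`|r| < q)%N by have := @ltz_pmod (a * u) q%:Z; rewrite -/r; lia.
exists (Ordinal rq), (x * v%:~R + ((a * u) %/ q%:Z)%Z%:~R).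
  by rewrite rpredD ?rpredM ?rpred_int.
have e1 : x = a%:~R * u%:~R + x * v%:~R * q%:R.
  have : (u * m%:Z + v * q%:Z)%:~R = 1 :> rat by rewrite uv.
  rewrite rmorphD !rmorphM /= -ea -!pmulrn => e.
  rewrite -[LHS]mulr1.
  by transitivity (x * (u%:~R * m%:R + v%:~R * q%:R)); [rewrite e|ring].
have e2 : a%:~R * u%:~R = ((a * u) %/ q%:Z)%Z%:~R * q%:R + `|r|%N%:R :> rat.
  have -> : `|r|%N%:R = r%:~R :> rat by rewrite pmulrn gez0_abs.
  by rewrite -rmorphM /= {1}(divz_eq (a * u) q%:Z) rmorphD rmorphM /= -pmulrn.
by rewrite /= {1}e1 e2 -mulr_natr; ring.
Qed.

Lemma porder_Zloc p : prime p -> porder p 'I_(p ^ 2) (Zloc p).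
Proof.
move=> pp; split; last by move=> t t0; exists idfun.
have H x : exists k : 'I_(p ^ 2), x \in Zloc p ->
    exists2 z, z \in Zloc p & x - k%:R = z *+ (p ^ 2).
  case: (boolP (x \in Zloc p)) => [/(Zloc_residue pp)[k kP]|_]; first by exists k.
  have q0 : (0 < p ^ 2)%N by rewrite expn_gt0 prime_gt0.
  by exists (Ordinal q0).
have [red redP] := choice H.
exists red => x y /redP[z zO ez] /redP[w wO ew] e.
exists (z - w); first by rewrite rpredB.
by rewrite mulrnBl -ez -ew e opprB addrA subrK.
Qed.

Definition algebraic_over (K : fieldType) (S : {pred K}) (y : K) : Prop :=
  exists P : {poly K}, [/\ P \is a polyOver S, P != 0 & root P y].

Lemma algebraic_over_sub (K : fieldType) (S S' : {pred K}) y :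
  {subset S <= S'} -> algebraic_over S y -> algebraic_over S' y.
Proof. by move=> SS [P [PS P0 Py]]; exists P; split=> //; exact: (polyOverS SS). Qed.

Definition adjoin (K : fieldType) (S : {pred K}) (y : K) : {pred K} :=
  fun x => `[< exists2 P : {poly K}, P \is a polyOver S & x = P.[y] >].

Lemma adjoinP (K : fieldType) (S : {pred K}) y x :
  reflect (exists2 P : {poly K}, P \is a polyOver S & x = P.[y]) (x \in adjoin S y).
Proof. exact: asboolP. Qed.

Lemma adjoin_subring (K : fieldType) (S : subringClosed K) y : subring_closed (adjoin S y).
Proof.
split=> [|_ _ /adjoinP[P PS ->] /adjoinP[Q QS ->]|_ _ /adjoinP[P PS ->] /adjoinP[Q QS ->]].
- by apply/adjoinP; exists 1; rewrite ?rpred1 // hornerC.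
- by apply/adjoinP; exists (P - Q); rewrite ?rpredB // hornerD hornerN.
- by apply/adjoinP; exists (P * Q); rewrite ?rpredM // hornerM.
Qed.
HB.instance Definition _ (K : fieldType) (S : subringClosed K) y :=
  GRing.isSubringClosed.Build K (adjoin S y) (adjoin_subring S y).

Lemma adjoin_sub (K : fieldType) (S : subringClosed K) y : {subset S <= adjoin S y}.
Proof. by move=> x xS; apply/adjoinP; exists x%:P; rewrite ?polyOverC // hornerC. Qed.

Lemma adjoin_gen (K : fieldType) (S : subringClosed K) y : y \in adjoin S y.
Proof. by apply/adjoinP; exists 'X; rewrite ?polyOverX // hornerX. Qed.

(** Specialisation into Z_(p) itself. The transcendental step needs this form, since it perturbs a
    unit by a multiple of p, which is harmless in a local ring. *)
Definition good_rational_subring (K : fieldType) (S : {pred K}) : Prop :=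
  forall g, g \in S -> g != 0 -> exists2 p : nat, prime p &
    forall x, x \in S -> x != 0 -> exists phi : K -> rat,
      [/\ hom_on S (Zloc p) phi, phi x != 0 & exists2 h, h \in Zloc p & phi g * h = 1].

Lemma good_rational_good (K : fieldType) (S : {pred K}) :
  good_rational_subring S -> good_subring S.
Proof.
move=> gS g gS' g0; have [p pp H] := gS g gS' g0.
exists p, 'I_(p ^ 2); split=> // x xS x0; have [phi [h1 h2 h3]] := H x xS x0.
exists rat, (GRing.SubringClosed.clone rat (Zloc p) _), phi; split=> //; exact: porder_Zloc.
Qed.

Definition int_subring (K : fieldType) : {pred K} := fun x => `[< exists n : int, x = n%:~R >].

Lemma int_subringP (K : fieldType) (x : K) :
  reflect (exists n : int, x = n%:~R) (x \in @int_subring K).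
Proof. exact: asboolP. Qed.

Lemma int_subring_closed (K : fieldType) : subring_closed (@int_subring K).
Proof.
split=> [|_ _ /int_subringP[m ->] /int_subringP[n ->]|_ _ /int_subringP[m ->] /int_subringP[n ->]].
- by apply/int_subringP; exists 1.
- by apply/int_subringP; exists (m - n); rewrite rmorphB.
- by apply/int_subringP; exists (m * n); rewrite rmorphM.
Qed.
HB.instance Definition _ (K : fieldType) :=
  GRing.isSubringClosed.Build K (@int_subring K) (@int_subring_closed K).

Lemma pchar0_intr_inj (K : fieldType) : [pchar K] =i pred0 -> injective (fun n : int => n%:~R : K).
Proof.
move=> /pcharf0P K0 m n /eqP; rewrite -subr_eq0 -rmorphB /= => /eqP e.
apply/eqP; rewrite -subr_eq0 -absz_eq0 -K0; apply/eqP.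
case: (intP (m - n)) e => [|k|k] //=.
by rewrite rmorphN /= => /eqP; rewrite oppr_eq0 => /eqP.
Qed.

Lemma good_int_subring (K : fieldType) : [pchar K] =i pred0 ->
  good_rational_subring (@int_subring K).
Proof.
move=> K0 g /int_subringP[n ->] n0.
have inj := pchar0_intr_inj K0.
(* A prime above |n| does not divide n, so n becomes a unit of Z_(p). *)
have [p np pp] := prime_above `|n|%N.
have n0' : n != 0 by apply: contraNneq n0 => ->.
have H (x : K) : exists k : int, x \in @int_subring K -> x = k%:~R.
  case: (boolP (x \in @int_subring K)) => [/int_subringP[k ->]|_]; last by exists 0.
  by exists k.
have [f fP] := choice H.
have fE k : f k%:~R = k.
  by apply: inj; rewrite -fP //; apply/int_subringP; exists k.
exists p => // x xS x0; exists (fun x => (f x)%:~R); split.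
- split.
  + by rewrite (fE 1).
  + move=> _ _ /int_subringP[a ->] /int_subringP[b ->].
    by rewrite -rmorphB /= !fE rmorphB.
  + move=> _ _ /int_subringP[a ->] /int_subringP[b ->].
    by rewrite -rmorphM /= !fE rmorphM.
  + by move=> y _; rewrite rpred_int.
- by rewrite intr_eq0; apply: contraNneq x0 => e; rewrite (fP x) // e.
exists (n%:~R)^-1; last by rewrite fE mulfV // intr_eq0.
have -> : (n%:~R : rat) = (-1) ^+ (n < 0)%R * `|n|%N%:R.
  by rewrite {1}[n]intEsign rmorphM /= rmorphXn /= rmorphN1.
rewrite invfM rpredM ?Zloc_inv_nat // ?invr_sign ?rpredX ?rpredN1 //.
rewrite prime_coprime //; apply/negP => /dvdn_leq; rewrite absz_gt0 n0' => /(_ isT).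
by rewrite leqNgt np.
Qed.

Lemma horner_over (K : fieldType) (S : subringClosed K) (P : {poly K}) x :
  P \is a polyOver S -> x \in S -> P.[x] \in S.
Proof. by move=> PS xS; apply: rpred_horner. Qed.

Lemma poly_nonroot_ap (K : fieldType) (P : {poly K}) (k p : nat) :
  [pchar K] =i pred0 -> (0 < p)%N -> P != 0 -> exists j : nat, P.[(k + p * j)%:R] != 0.
Proof.
move=> K0 p0 P0; apply: contrapT => H.
have inj := pchar0_intr_inj K0.
pose rs : seq K := [seq (k + p * j)%:R | j <- iota 0 (size P)].
have : (size rs < size P)%N.
  apply: max_poly_roots => //.
    apply/allP=> _ /mapP[j _ ->]; apply/negPn/negP => Hj; apply: H; exists j; exact: Hj.
  rewrite map_inj_uniq ?iota_uniq // => i j; rewrite !pmulrn => /inj [].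
  by move/eqP; rewrite eqn_add2l eqn_pmul2l // => /eqP.
by rewrite size_map size_iota ltnn.
Qed.

(** An element of S[y] is P(y) for a unique P, and it is sent to phi(P(k)) for an integer k. A value
    k0 with G(k0) nonzero determines p; then k = k0 + p j is chosen with X(k) nonzero. Since G(k)
    and G(k0) differ by a multiple of p, the image of G(y) remains a unit. *)
Lemma good_rational_transcendental (K : fieldType) (S : subringClosed K) y :
  [pchar K] =i pred0 -> good_rational_subring S -> ~ algebraic_over S y ->
  good_rational_subring (adjoin S y).
Proof.
move=> K0 gS ty.
have uniqP P Q : P \is a polyOver S -> Q \is a polyOver S -> P.[y] = Q.[y] -> P = Q.
  move=> PS QS e; apply/eqP; rewrite -subr_eq0; apply/negPn/negP => n0; apply: ty.
  by exists (P - Q); split; rewrite ?rpredB // /root hornerD hornerN e subrr.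
have H x : exists P : {poly K}, x \in adjoin S y -> P \is a polyOver S /\ x = P.[y].
  by case: (boolP (x \in adjoin S y)) => [/adjoinP[P PS ->]|_]; [exists P|exists 0].
have [f fP] := choice H.
have fE P : P \is a polyOver S -> f P.[y] = P.
  move=> PS; have [|fS e] := fP P.[y]; first by apply/adjoinP; exists P.
  exact: uniqP.
move=> _ /adjoinP[G GS ->] g0.
have G0 : G != 0 by apply: contraNneq g0 => ->; rewrite horner0.
have [k0] := poly_nonroot_ap 0 K0 (ltn0Sn 0) G0; rewrite add0n mul1n => Gk0.
have [p pp HS] := gS _ (horner_over GS (rpred_nat _ k0)) Gk0.
exists p => // _ /adjoinP[X XS ->] x0.
have X0 : X != 0 by apply: contraNneq x0 => ->; rewrite horner0.
have [j Xj] := poly_nonroot_ap k0 K0 (prime_gt0 pp) X0.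
set k := (k0 + p * j)%N in Xj.
have [phi [hphi phiX [h hO gh]]] := HS _ (horner_over XS (rpred_nat _ k)) Xj.
have evS P : P \is a polyOver S -> P.[k%:R] \in S.
  by move=> PS; apply: horner_over => //; exact: rpred_nat.
exists (fun x => phi (f x).[k%:R]); split.
- split.
  + by rewrite -[1](hornerC 1 y) fE ?rpred1 // hornerC (hom_on1 hphi).
  + move=> _ _ /adjoinP[P PS ->] /adjoinP[Q QS ->].
    rewrite -hornerN -hornerD !fE ?rpredB // hornerD hornerN (hom_onB hphi) //; exact: evS.
  + move=> _ _ /adjoinP[P PS ->] /adjoinP[Q QS ->].
    rewrite -hornerM !fE ?rpredM // hornerM (hom_onM hphi) //; exact: evS.
  + by move=> _ /adjoinP[P PS ->]; rewrite fE // (hom_on_in hphi) // evS.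
- by rewrite fE.
rewrite fE //.
(* k^i - k0^i is divisible by k - k0 = p j, and D collects the cofactors. *)
have [D DS eD] : exists2 D, D \in S & G.[k%:R] = G.[k0%:R] + p%:R * D.
  exists (\sum_(i < size G) G`_i * (j%:R * \sum_(l < i) k%:R ^+ (i.-1 - l) * k0%:R ^+ l)).
    rewrite rpred_sum // => i _; rewrite rpredM ?(polyOverP GS) // rpredM ?rpred_nat //.
    by rewrite rpred_sum // => l _; rewrite rpredM // rpredX // rpred_nat.
  rewrite !horner_coef mulr_sumr -big_split; apply: eq_bigr => i _ /=.
  apply/eqP; rewrite addrC -subr_eq -mulrBr subrXX /k natrD natrM; apply/eqP.
  by rewrite [k0%:R + _]addrC addrK; ring.
rewrite eD (hom_onD hphi) ?(hom_onM hphi) ?rpredM ?rpred_nat //; last by apply: horner_over; rewrite ?rpred_nat.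
rewrite (hom_on_nat hphi).
apply: (Zloc_local pp _ hO gh); rewrite (hom_on_in hphi) //.
by apply: horner_over; rewrite ?rpred_nat.
Qed.

(** The ring is Z[t_1, ..., t_r] for a transcendence basis extracted from s: an element is adjoined
    only when it is not algebraic over the ring built so far. *)
Lemma transcendence_subring (K : fieldType) (s : seq K) : [pchar K] =i pred0 ->
  exists S : subringClosed K, good_rational_subring S /\
    forall y, y \in s -> algebraic_over S y.
Proof.
move=> K0; elim: s => [|y s [S [gS sS]]].
  by exists (GRing.SubringClosed.clone K (@int_subring K) _); split => //; exact: good_int_subring.
have [ay|ty] := EM (algebraic_over S y).
  by exists S; split=> // z; rewrite inE => /orP[/eqP->|/sS].
exists (GRing.SubringClosed.clone K (adjoin S y) _); split.
  exact: good_rational_transcendental.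
move=> z; rewrite inE => /orP[/eqP->|/sS]; last exact/algebraic_over_sub/adjoin_sub.
exists ('X - y%:P); rewrite polyXsubC_eq0 root_XsubC eqxx polyOverXsubC; split=> //.
exact: adjoin_gen.
Qed.

(** * Algebraic extensions and the Skolem-Mahler-Lech theorem *)

(** In a polynomial relation for x, the terms of positive degree form a multiple of x equal to minus
    the constant term. A zero constant term is removed by dividing the relation by X, as x is
    nonzero. *)
Lemma algebraic_cofactor (K : fieldType) (S : subringClosed K) x :
  algebraic_over S x -> x != 0 ->
  exists Q c, [/\ Q \is a polyOver S, c \in S, c != 0 & Q.[x] * x = c].
Proof.
move=> [P [PS P0 Px]] x0; elim/poly_ind: P PS P0 Px => [|P c IH]; first by rewrite eqxx.
move=> PS P0; rewrite /root hornerMXaddC => /eqP Px.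
have cS : c \in S by have /polyOverP/(_ 0%N) := PS; rewrite coefD coefMX coefC /= add0r.
have {}PS : P \is a polyOver S.
  apply/polyOverP=> i; have /polyOverP/(_ i.+1) := PS.
  by rewrite coefD coefMX coefC /= addr0.
have [c0|c0] := eqVneq c 0; last first.
  exists (- P), (c); split; rewrite ?rpredN // hornerN mulNr.
  by apply/eqP; rewrite eqr_oppLR -subr_eq0 opprK Px.
apply: IH => //; first by apply: contraNneq P0 => ->; rewrite c0 mul0r addr0.
by move/eqP: Px; rewrite c0 addr0 mulf_eq0 (negPf x0) orbF.
Qed.

Lemma char_poly_over (K : fieldType) (S : subringClosed K) n (A : 'M[K]_n) :
  A \is a mxOver S -> char_poly A \is a polyOver S.
Proof.
move=> /mxOverP AS.
apply: (mxOver_adj (S := GRing.SubringClosed.clone {poly K} (polyOver_pred S) _) _).1.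
apply/mxOverP=> i j; rewrite !mxE rpredB //; first by rewrite rpredMn // polyOverX.
by rewrite polyOverC.
Qed.

Section FreeExtension.
Variables (K : fieldType) (S S' : subringClosed K) (e : nat) (b : 'cV[K]_e.+1).
Hypothesis subS : {subset S <= S'}.
Hypothesis bS' : b \is a mxOver S'.
Hypothesis spanb : forall x, x \in S' ->
  exists2 c : 'rV_e.+1, c \is a mxOver S & x = (c *m b) 0 0.
Hypothesis freeb : forall c : 'rV_e.+1, c \is a mxOver S -> c *m b = 0 -> c = 0.

Let freeM n (A B : 'M[K]_(n, e.+1)) : A \is a mxOver S -> B \is a mxOver S ->
  A *m b = B *m b -> A = B.
Proof.
move=> AS BS AB; apply/eqP; rewrite -subr_eq0; apply/eqP/row_matrixP => i.
rewrite row0; apply: freeb.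
  apply/mxOverP => k l; rewrite !mxE rpredB //; exact/mxOverP.
by rewrite -row_mul mulmxBl AB subrr row0.
Qed.

(** The regular representation: row i of M x holds the coordinates of x b_i. Freeness makes these
    matrices unique, and hence M additive and multiplicative on S'. *)
Lemma mult_matrix : exists M : K -> 'M[K]_e.+1,
  forall x, x \in S' -> M x \is a mxOver S /\ x *: b = M x *m b.
Proof.
suff H x : exists M : 'M[K]_e.+1, x \in S' -> M \is a mxOver S /\ x *: b = M *m b.
  by have [M MP] := choice H; exists M.
case: (boolP (x \in S')) => xS; last by exists 0.
have H i : exists c : 'rV_e.+1, c \is a mxOver S /\ x * b i 0 = (c *m b) 0 0.
  have [|c cS ec] := spanb (x := x * b i 0); first by rewrite rpredM // (mxOverP bS').
  by exists c.
have [c cP] := choice H.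
exists (\matrix_(i, j) c i 0 j); split.
  by apply/mxOverP => i j; rewrite mxE; have [/mxOverP] := cP i.
apply/matrixP => i j; rewrite (ord1 j) [LHS]mxE (cP i).2 !mxE.
by apply: eq_bigr => k _; rewrite mxE.
Qed.

(** The transpose of b is an eigenvector of the transpose of M x for the eigenvalue x, and the
    characteristic polynomial is monic over S. It is nonzero because its entries span 1. *)
Lemma free_ext_algebraic x : x \in S' -> algebraic_over S x.
Proof.
have [M MP] := mult_matrix => xS; have [MS Mb] := MP x xS.
exists (char_poly (M x)^T); split.
- by apply: char_poly_over; apply/mxOverP=> i j; rewrite mxE; exact/mxOverP.
- exact: monic_neq0 (char_poly_monic _).
rewrite -eigenvalue_root_char; apply/eigenvalueP; exists b^T.
  by rewrite -trmx_mul -Mb linearZ.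
apply/eqP => b0; have [c _ e1] := spanb (rpred1 S').
by move/eqP: e1; rewrite -[b]trmxK b0 trmx0 mulmx0 mxE oner_eq0.
Qed.

(** The new homomorphism is phi applied entrywise to the regular representation. Cofactors z g = s
    and w x = t with nonzero s, t in S reduce the conditions on g and x to S: p and R are chosen for
    s, then phi for t. *)
Lemma good_free_ext : good_subring S -> good_subring S'.
Proof.
move=> gS; have [M MP] := mult_matrix.
have MS x : x \in S' -> M x \is a mxOver S by case/MP.
have Mb x : x \in S' -> x *: b = M x *m b by case/MP.
have Muniq x A : x \in S' -> A \is a mxOver S -> x *: b = A *m b -> M x = A.
  by move=> xS AS xA; apply: freeM => //; [exact: MS|rewrite -Mb].
have M_S s : s \in S -> M s = s%:M.
  by move=> sS; apply: Muniq; rewrite ?subS ?mul_scalar_mx // mxOver_scalar ?rpred0.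
have M_B : {in S' &, {morph M : x y / x - y}}.
  move=> x y xS yS; apply: Muniq; first by rewrite rpredB.
    by apply/mxOverP=> i j; rewrite !mxE rpredB //; apply/mxOverP; exact: MS.
  by rewrite scalerBl !Mb // mulmxBl.
have M_M : {in S' &, {morph M : x y / x * y >-> x *m y}}.
  move=> x y xS yS; apply: Muniq; first by rewrite rpredM.
    by apply: mxOverM; exact: MS.
  by rewrite mulrC -scalerA Mb // scalemxAr Mb // mulmxA.
have cof x : x \in S' -> x != 0 -> exists z c, [/\ z \in S', c \in S, c != 0 & z * x = c].
  move=> xS x0; have [Q [c [QS cS c0 e']]] := algebraic_cofactor (free_ext_algebraic xS) x0.
  by exists Q.[x], c; split=> //; apply: horner_over => //; exact: (polyOverS subS).
move=> g gS' g0; have [z [s [zS sS s0 zg]]] := cof g gS' g0.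
have [p [R [pp H]]] := gS s sS s0.
exists p, {ffun 'I_e.+1 * 'I_e.+1 -> R}; split=> // x xS x0.
have [w [t [wS tS t0 wx]]] := cof x xS x0.
have [T [T0 [phi [poT hphi phit [h hT sh]]]]] := H t tS t0.
pose psi x := map_mx phi (M x).
have hpsi : hom_on S' (mxOver_subring T0 e.+1) psi.
  split.
  - by rewrite /psi M_S ?rpred1 // (hom_on_scalar_mx hphi) (hom_on1 hphi).
  - move=> u v uS vS; rewrite /psi M_B //; apply/matrixP=> i j; rewrite !mxE (hom_onB hphi) //.
      by apply/mxOverP; exact: MS.
    by apply/mxOverP; exact: MS.
  - by move=> u v uS vS; rewrite /psi M_M // (hom_on_mulmx hphi) ?MS.
  - by move=> u uS; apply: (hom_on_mxOver hphi); exact: MS.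
have psiS a : a \in S -> psi a = (phi a)%:M.
  by move=> aS; rewrite /psi M_S // (hom_on_scalar_mx hphi).
exists 'M[T]_e.+1, (mxOver_subring T0 e.+1), psi; split=> //.
- exact: porder_matrix.
- apply: contraNneq phit => psix.
  have : psi w * psi x = (phi t)%:M by rewrite -(hom_onM hpsi) // wx psiS.
  by rewrite psix mulr0 => /matrixP/(_ 0 0); rewrite !mxE mulr1n => <-.
exists (psi z *m h%:M).
  apply: mxOverM; last by rewrite mxOver_scalar ?rpred0.
  by apply: (hom_on_mxOver hphi); exact: MS.
by rewrite -mulmxE mulmxA mulmxE -(hom_onM hpsi) // mulrC zg psiS // -mulmxE -scalar_mxM sh.
Qed.
End FreeExtension.

(** For P of minimal degree e + 1 over S with root y and leading coefficient a, the element a y is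
    integral over S, and by minimality its powers 1, ..., (a y)^e form a basis of S[a y] over S. *)
Lemma good_algebraic (K : fieldType) (S : subringClosed K) y :
  good_subring S -> algebraic_over S y ->
  exists S' : subringClosed K, [/\ good_subring S', {subset S <= S'} &
    exists a, [/\ a \in S', a != 0 & a * y \in S']].
Proof.
move=> gS ay.
pose D n := `[< exists P : {poly K}, [/\ P \is a polyOver S, P != 0, root P y & size P = n] >].
have exD : exists n, D n.
  by case: ay => P [PS P0 Py]; exists (size P); apply/asboolP; exists P.
case: (ex_minnP exD) => n /asboolP[P [PS P0 Py sP]] minD.
have Pmin Q : Q \is a polyOver S -> root Q y -> (size Q < size P)%N -> Q = 0.
  move=> QS Qy sQ; apply/eqP/negPn/negP => Q0.
  have : (n <= size Q)%N by apply: minD; apply/asboolP; exists Q.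
  by rewrite -sP leqNgt sQ.
have sP1 : (1 < size P)%N by exact: root_size_gt1 Py.
case E : (size P) sP1 => [|[|e]] // _.
pose a := lead_coef P; pose y' := a * y.
have aS : a \in S by exact/polyOverP.
have a0 : a != 0 by rewrite lead_coef_eq0.
(* a^e P(y) = 0 is a monic equation of degree e + 1 for y'. *)
have y'E : y' ^+ e.+1 = \sum_(i < e.+1) (- (P`_i * a ^+ (e - i))) * y' ^+ i.
  apply/eqP; rewrite -subr_eq0 -sumrN; apply/eqP.
  transitivity (a ^+ e * P.[y]); last by rewrite (eqP Py) mulr0.
  rewrite horner_coef E [in RHS]big_ord_recr /= mulrDr addrC; congr (_ + _).
    rewrite mulr_sumr; apply: eq_bigr => i _; rewrite mulNr opprK /y' exprMn.
    have ie : (i <= e)%N by rewrite -ltnS.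
    have -> : a ^+ e = a ^+ (e - i) * a ^+ i by rewrite -exprD subnK.
    by ring.
  by rewrite /y' exprMn /a /lead_coef E /= exprSr mulrA.
pose b : 'cV[K]_e.+1 := \col_i y' ^+ i.
have cbE (c : 'rV[K]_e.+1) : (c *m b) 0 0 = \sum_(i < e.+1) c 0 i * y' ^+ i.
  by rewrite mxE; apply: eq_bigr => i _; rewrite mxE.
pose S' := adjoin S y'.
exists (GRing.SubringClosed.clone K S' _); split; last first.
  exists a; split=> //; [exact: adjoin_sub|exact: adjoin_gen].
  exact: adjoin_sub.
apply: (good_free_ext (S := S) (b := b)) => //; first exact: adjoin_sub.
- by apply/mxOverP=> i j; rewrite mxE; apply: rpredX; exact: adjoin_gen.
- move=> _ /adjoinP[Q QS ->]; elim/poly_ind: Q QS => [|Q c IH] QS.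
    by exists 0; rewrite ?mxOver0 ?rpred0 // mul0mx mxE horner0.
  have cS : c \in S by have /polyOverP/(_ 0%N) := QS; rewrite coefD coefMX coefC /= add0r.
  have {}QS : Q \is a polyOver S.
    apply/polyOverP=> i; have /polyOverP/(_ i.+1) := QS.
    by rewrite coefD coefMX coefC /= addr0.
  have [d /mxOverP dS ed] := IH QS.
  (* Multiplication by y' shifts the coordinates of Q(y'), c enters at index 0, and the top power
     that overflows is rewritten by [y'E]. *)
  exists (\row_(i < e.+1) ((if i == 0%N :> nat then c else d 0 (inord i.-1)) +
       d 0 ord_max * (- (P`_i * a ^+ (e - i))))).
    apply/mxOverP=> i j; rewrite mxE rpredD //; first by case: ifP.
    by rewrite rpredM // rpredN rpredM ?rpredX // (polyOverP PS).
  rewrite hornerMXaddC ed !cbE mulr_suml.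
  under [in RHS]eq_bigr do rewrite mxE mulrDl -mulrA.
  rewrite [in RHS]big_split /= -mulr_sumr -y'E.
  rewrite big_ord_recr /= [in RHS]big_ord_recl /= expr0 mulr1 exprSr !mulrA.
  rewrite [LHS]addrC addrA; congr (_ + _ + _).
  apply: eq_bigr => i _; rewrite /bump /= add0n add1n exprSr [in RHS]mulrA; congr (d 0 _ * _ * _).
  by apply: val_inj; rewrite /= inordK // ltnS ltnW.
- move=> c cS cb0; pose Q := \poly_(i < e.+1) (if insub i is Some j then c 0 j else 0).
  have Qc (i : 'I_e.+1) : Q`_i = c 0 i by rewrite coef_poly ltn_ord valK.
  have QS : Q \is a polyOver S.
    apply: polyOver_poly => i _; case: insub => [j|]; [exact: (mxOverP cS)|exact: rpred0].
  (* Q(a X) has coefficients in S, vanishes at y and has degree at most e, below the minimal one. *)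
  have Q0 : Q \Po (a *: 'X) = 0.
    apply: Pmin.
    - by apply: polyOver_comp => //; rewrite polyOverZ // polyOverX.
    - rewrite /root horner_comp hornerZ hornerX (horner_coef_wide _ (size_poly _ _)).
      under eq_bigr do rewrite Qc.
      by rewrite -cbE cb0 mxE.
    rewrite size_comp_poly2 ?E ?ltnS ?size_poly //.
    by rewrite size_scale // size_polyX.
  have {}Q0 : Q = 0.
    have sX : (1 < size (a *: 'X : {poly K}))%N by rewrite size_scale // size_polyX.
    by apply/eqP; rewrite -(comp_poly_eq0 Q sX) Q0.
  by apply/matrixP=> i j; rewrite (ord1 i) -Qc Q0 coef0 mxE.
Qed.

Lemma good_common_denominator (K : fieldType) (s : seq K) (S : subringClosed K) :
  good_subring S -> (forall y, y \in s -> algebraic_over S y) ->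
  exists S' : subringClosed K, [/\ good_subring S', {subset S <= S'} &
    exists D, [/\ D \in S', D != 0 & forall y, y \in s -> D * y \in S']].
Proof.
elim: s S => [|y s IH] S gS aS.
  by exists S; split=> //; exists 1; rewrite rpred1 oner_eq0.
have [S1 [gS1 sub1 [a [aS1 a0 ayS1]]]] := good_algebraic gS (aS y (mem_head _ _)).
have [|S2 [gS2 sub2 [D [DS D0 DP]]]] := IH S1 gS1.
  by move=> z zs; apply: (algebraic_over_sub sub1); apply: aS; rewrite inE zs orbT.
exists S2; split=> //; first by move=> z /sub1 /sub2.
exists (D * a); split; [by rewrite rpredM // (sub2 _ aS1)|by rewrite mulf_neq0|].
move=> z; rewrite inE => /orP[/eqP->|zs]; first by rewrite -mulrA rpredM // (sub2 _ ayS1).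
by rewrite mulrAC rpredM ?DP // (sub2 _ aS1).
Qed.

Definition eventually_periodic (P : nat -> bool) : Prop :=
  exists2 N, (0 < N)%N & exists n0, forall n, (n0 <= n)%N -> P (n + N)%N = P n.

(** In each class mod N, P holds either everywhere or only finitely often, hence is eventually
    constant; the largest of the N thresholds bounds the preperiod. *)
Lemma eventually_periodic_residue (P : nat -> bool) N : (0 < N)%N ->
  (forall r, (forall M, exists2 n, (M <= n)%N & P (r + N * n)%N) ->
     forall n, P (r + N * n)%N) ->
  eventually_periodic P.
Proof.
move=> N0 H; exists N => //.
have B r : exists n0, forall n, (n0 <= n)%N -> P (r + N * n.+1)%N = P (r + N * n)%N.
  have [inf|fin] := EM (forall M, exists2 n, (M <= n)%N & P (r + N * n)%N).
    by exists 0%N => n _; rewrite !H.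
  have [M HM] : exists M, forall n, (M <= n)%N -> ~~ P (r + N * n)%N.
    apply: contrapT => HM; apply: fin => M; apply: contrapT => HM'; apply: HM.
    by exists M => n Mn; apply/negP => Pn; apply: HM'; exists n.
  by exists M => n Mn; rewrite !(negPf (HM _ _)) // leqW.
have [f fP] := choice B.
exists (N * (\max_(r < N) f r).+1)%N => n nN.
have -> : (n + N)%N = (n %% N + N * (n %/ N).+1)%N by rewrite {1}(divn_eq n N); lia.
rewrite fP; first by congr (P _); rewrite {3}(divn_eq n N); lia.
have rN : (n %% N < N)%N by rewrite ltn_mod.
apply: leq_trans (leq_bigmax (F := fun r : 'I_N => f r) (Ordinal rN)) _.
by rewrite leq_divRL // mulnC; apply: leq_trans nN; rewrite leq_mul2l leqnSn orbT.
Qed.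

Lemma eventually_periodic_shift (P : nat -> bool) :
  eventually_periodic (fun n => P n.+1) -> eventually_periodic P.
Proof.
case=> N N0 [n0 H]; exists N => //; exists n0.+1 => -[|n] // nn.
by rewrite addSn H.
Qed.

(** Induction on the size. A singular A factors as B C through its rank, and u A^(n+1) v = (u B) (C
    B)^n (C v) involves a smaller matrix. For invertible A, scaling A, u and v by a common
    denominator D multiplies each term by a nonzero factor and moves all entries into a good
    subring. *)
Theorem skolem_mahler_lech (K : fieldType) m (A : 'M[K]_m) (u : 'rV_m) (v : 'cV_m) :
  [pchar K] =i pred0 ->
  eventually_periodic (fun n => (u *m A ^+ n *m v) 0 0 == 0).
Proof.
move=> K0; have [k] := ubnP m; elim: k m A u v => // k IH m A u v mk.
have [uA|sA] := boolP (A \in unitmx); last first.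
  have rm : (\rank A < m)%N.
    by rewrite ltn_neqAle rank_leq_row andbT; move: sA; rewrite -row_free_unit.
  have eA := esym (mulmx_base A).
  move: (\rank A) (col_base A) (row_base A) rm eA => r B C rm eA.
  apply: eventually_periodic_shift.
  have := IH _ (C *m B) (u *m B) (C *m v).
  case; first by apply: (leq_trans rm); rewrite -ltnS.
  move=> N N0 [n0 H]; exists N => //; exists n0 => n nn; move: (H n nn).
  have E j : u *m A ^+ j.+1 *m v = u *m B *m (C *m B) ^+ j *m (C *m v).
    have -> : A ^+ j.+1 = B *m (C *m B) ^+ j *m C.
      elim: j => [|j IHj]; first by rewrite expr0 expr1 mulmx1.
      by rewrite exprSr IHj {1}eA exprSr -!mulmxE !mulmxA.
    by rewrite !mulmxA.
  by rewrite -!E.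
pose s := [seq A ij.1 ij.2 | ij : 'I_m * 'I_m] ++ [seq u 0 i | i : 'I_m] ++ [seq v i 0 | i : 'I_m].
have [S0 [gS0 aS0]] := transcendence_subring s K0.
have [S [gS _ [D [DS D0 DP]]]] := good_common_denominator (good_rational_good gS0) aS0.
have AS : D *: A \is a mxOver S.
  apply/mxOverP=> i j; rewrite mxE DP // mem_cat; apply/orP; left.
  by apply/mapP; exists (i, j); rewrite ?mem_enum.
have uS : D *: u \is a mxOver S.
  apply/mxOverP=> i j; rewrite mxE DP // !mem_cat (ord1 i); apply/orP; right; apply/orP; left.
  by apply/mapP; exists j; rewrite ?mem_enum.
have vS : D *: v \is a mxOver S.
  apply/mxOverP=> i j; rewrite mxE DP // !mem_cat (ord1 j); apply/orP; right; apply/orP; right.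
  by apply/mapP; exists i; rewrite ?mem_enum.
have dA : \det (D *: A) != 0.
  by rewrite detZ mulf_neq0 ?expf_neq0 //; move: uA; rewrite unitmxE unitfE.
have [N N0 H] := good_subring_zeros gS AS uS vS dA.
apply: (eventually_periodic_residue N0) => r inf n.
have E j : (((D *: u) *m (D *: A) ^+ j *m (D *: v)) 0 0 == 0) = ((u *m A ^+ j *m v) 0 0 == 0).
  have -> : (D *: A) ^+ j = D ^+ j *: A ^+ j.
    elim: j => [|j IHj]; first by rewrite !expr0 scale1r.
    by rewrite !exprS IHj -!mulmxE -scalemxAl -scalemxAr scalerA.
  rewrite -!(scalemxAl, scalemxAr) !scalerA mxE mulf_eq0.
  by rewrite (negPf (_ : _ != 0)) // !mulf_neq0 ?expf_neq0.
rewrite -E; apply/eqP; apply: H => M; have [n' n'M] := inf M.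
by rewrite -E => /eqP e; exists n'.
Qed.

(** * Minors, ranks and leading indices *)

Definition linear_recurrent (K : fieldType) (f : nat -> K) : Prop :=
  exists (m : nat) (A : 'M[K]_m) (u : 'rV_m) (v : 'cV_m),
    forall n, f n = (u *m A ^+ n *m v) 0 0.

Section LinearRecurrent.
Variable K : fieldType.
Implicit Types f g : nat -> K.

Lemma eq_linear_recurrent f g : f =1 g -> linear_recurrent f -> linear_recurrent g.
Proof. by move=> fg [m [A [u [v E]]]]; exists m, A, u, v => n; rewrite -fg. Qed.

Lemma linear_recurrent_const c : linear_recurrent (fun=> c : K).
Proof.
exists 1%N, 1, c%:M, 1%:M => n.
by rewrite expr1n !mulmx1 mxE mulr1n.
Qed.

Lemma linear_recurrentD f g : linear_recurrent f -> linear_recurrent g ->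
  linear_recurrent (fun n => f n + g n).
Proof.
move=> [m [A [u [v Ef]]]] [m' [B [w [z Eg]]]].
exists (m + m')%N, (block_mx A 0 0 B), (row_mx u w), (col_mx v z) => n.
have -> : block_mx A 0 0 B ^+ n = block_mx (A ^+ n) 0 0 (B ^+ n).
  elim: n => [|n IH]; first by rewrite !expr0 -scalar_mx_block.
  by rewrite !exprS IH -!mulmxE mulmx_block !mulmx0 !mul0mx !addr0 !add0r.
by rewrite mul_row_block !mulmx0 addr0 add0r mul_row_col mxE -Ef -Eg.
Qed.

(* The product is computed by iterating X |-> A X B on matrices. *)
Lemma linear_recurrentM f g : linear_recurrent f -> linear_recurrent g ->
  linear_recurrent (fun n => f n * g n).
Proof.
move=> [m [A [u [v Ef]]]] [m' [B [w [z Eg]]]].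
pose Phi := lin_mx (mulmx A \o mulmxr B).
exists (m * m')%N, Phi, (mxvec (v *m w)), (lin1_mx (mulmx u \o (mulmxr z \o vec_mx))) => n.
have -> : mxvec (v *m w) *m Phi ^+ n = mxvec (A ^+ n *m (v *m w) *m B ^+ n).
  elim: n => [|n IH]; first by rewrite !expr0 !mulmx1 mul1mx.
  rewrite exprSr -mulmxE mulmxA IH mul_vec_lin /= [in RHS]exprS [in RHS]exprSr -!mulmxE.
  by rewrite !mulmxA.
rewrite mul_rV_lin1 /= mxvecK Ef Eg.
transitivity (((u *m A ^+ n *m v) *m (w *m B ^+ n *m z)) 0 0); last by rewrite !mulmxA.
by rewrite [RHS]mxE big_ord1.
Qed.

Lemma linear_recurrent_sum I (r : seq I) (F : I -> nat -> K) :
  (forall i, linear_recurrent (F i)) -> linear_recurrent (fun n => \sum_(i <- r) F i n).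
Proof.
move=> FR; elim: r => [|i r IH].
  by apply: eq_linear_recurrent (linear_recurrent_const 0) => n; rewrite big_nil.
by apply: eq_linear_recurrent (linear_recurrentD (FR i) IH) => n; rewrite big_cons.
Qed.

Lemma linear_recurrent_prod I (r : seq I) (F : I -> nat -> K) :
  (forall i, linear_recurrent (F i)) -> linear_recurrent (fun n => \prod_(i <- r) F i n).
Proof.
move=> FR; elim: r => [|i r IH].
  by apply: eq_linear_recurrent (linear_recurrent_const 1) => n; rewrite big_nil.
by apply: eq_linear_recurrent (linear_recurrentM (FR i) IH) => n; rewrite big_cons.
Qed.

Lemma linear_recurrent_det k (M : nat -> 'M[K]_k) :
  (forall i j, linear_recurrent (fun n => M n i j)) -> linear_recurrent (fun n => \det (M n)).
Proof.
move=> MR; apply: linear_recurrent_sum => s.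
by apply: linear_recurrentM; [exact: linear_recurrent_const|exact: linear_recurrent_prod].
Qed.
End LinearRecurrent.

Lemma eventually_periodic_family (I : finType) (P : I -> nat -> bool) :
  (forall i, eventually_periodic (P i)) ->
  exists2 N, (0 < N)%N & exists n0, forall i n, (n0 <= n)%N -> P i (n + N)%N = P i n.
Proof.
move=> H.
have {}H i : exists Nn : nat * nat, (0 < Nn.1)%N /\
    forall n, (Nn.2 <= n)%N -> P i (n + Nn.1)%N = P i n.
  by have [N N0 [n0 Hn]] := H i; exists (N, n0).
have [f fP] := choice H.
exists (\prod_i (f i).1)%N; first by rewrite prodn_gt0 // => i; case: (fP i).
exists (\max_i (f i).2) => i n nn.
have {nn} ni : ((f i).2 <= n)%N by apply: leq_trans nn; exact: (leq_bigmax (F := fun i => (f i).2)).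
rewrite (bigD1 i) //= mulnC; move: (\prod_(j | j != i) _)%N => k.
elim: k => [|k IH]; first by rewrite addn0.
rewrite mulSn addnCA addnC (fP i).2 ?IH //.
by apply: leq_trans (leq_addr _ _).
Qed.

Lemma eventually_periodic_exists (I : finType) (P : I -> nat -> bool) :
  (forall i, eventually_periodic (P i)) -> eventually_periodic (fun n => [exists i, P i n]).
Proof.
move=> /eventually_periodic_family[N N0 [n0 H]]; exists N => //; exists n0 => n nn.
by apply: eq_existsb => i; exact: H.
Qed.

(** Rows and columns are selected by arbitrary functions; a repeated index gives determinant zero,
    so only genuine minors count. *)
Definition has_minor (K : fieldType) p q (M : 'M[K]_(p, q)) k : bool :=
  [exists fg : {ffun 'I_k -> 'I_p} * {ffun 'I_k -> 'I_q}, \det (mxsub fg.1 fg.2 M) != 0].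

Lemma has_minor_leq (K : fieldType) p q (M : 'M[K]_(p, q)) k :
  has_minor M k -> (k <= \rank M)%N.
Proof.
case/existsP=> -[f g] /= dM.
have /eqP rk : \rank (mxsub f g M) == k.
  by rewrite -[_ == _]/(row_free _) row_free_unit unitmxE unitfE.
have e : mxsub f g M = rowsub f (rowsub g M^T)^T.
  by apply/matrixP=> i j; rewrite !mxE.
rewrite -{1}rk e; apply: leq_trans (mxrankS (rowsub_sub _ _)) _.
by rewrite mxrank_tr -[leqRHS]mxrank_tr; exact: mxrankS (rowsub_sub _ _).
Qed.

Lemma has_minor_rank (K : fieldType) p q (M : 'M[K]_(p, q)) : has_minor M (\rank M).
Proof.
have fr := maxrowsub_free M; move: fr; set f := maxrankfun M => fr.
pose B := (rowsub f M)^T.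
have rB : \rank B = \rank M by rewrite mxrank_tr; exact/eqP.
have frB := maxrowsub_free B; move: (maxrankfun B) frB; rewrite rB => g frB.
apply/existsP; exists (f, g) => /=.
have e : mxsub f g M = (rowsub g B)^T by apply/matrixP=> i j; rewrite !mxE.
by rewrite e det_tr -unitfE -unitmxE -row_free_unit.
Qed.

Lemma rank_eq_minors (K : fieldType) p q (M M' : 'M[K]_(p, q)) :
  (forall k : 'I_p.+1, has_minor M k = has_minor M' k) -> \rank M = \rank M'.
Proof.
have aux (X Y : 'M[K]_(p, q)) : (forall k : 'I_p.+1, has_minor X k = has_minor Y k) ->
    (\rank X <= \rank Y)%N.
  move=> H; have rX : (\rank X < p.+1)%N by rewrite ltnS rank_leq_row.
  by apply: has_minor_leq; rewrite -(H (Ordinal rX)) /= has_minor_rank.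
by move=> H; apply/eqP; rewrite eqn_leq !aux // => k; rewrite H.
Qed.

(** The rank is the largest order of a nonzero minor. There are finitely many minors, each linear
    recurrent in n, so their vanishing patterns share a period. *)
Lemma eventually_periodic_rank (K : fieldType) m p q (sigma : 'M[K]_m)
    (L : 'M_(p, m)) (G : 'M_(q, m)) : [pchar K] =i pred0 ->
  exists2 N, (0 < N)%N & exists n0, forall n, (n0 <= n)%N ->
    \rank (col_mx (L *m sigma ^+ (n + N)) G) = \rank (col_mx (L *m sigma ^+ n) G).
Proof.
move=> K0; pose M n := col_mx (L *m sigma ^+ n) G.
have Mlr i j : linear_recurrent (fun n => M n i j).
  case: (split_ordP i) => k ->; last first.
    by apply: eq_linear_recurrent (linear_recurrent_const (G k j)) => n; rewrite col_mxEd.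
  exists m, sigma, (row k L), (col j 1%:M) => n.
  by rewrite col_mxEu colE mulmxA -colE -row_mul mulmx1 !mxE.
have H (k : 'I_(p + q).+1) : eventually_periodic (fun n => has_minor (M n) k).
  apply: eventually_periodic_exists => -[f g] /=.
  have [] : linear_recurrent (fun n => \det (mxsub f g (M n))).
    by apply: linear_recurrent_det => i j; apply: eq_linear_recurrent (Mlr (f i) (g j)) => n; rewrite [RHS]mxE.
  move=> r [A [u [v E]]]; have [N N0 [n0 P]] := skolem_mahler_lech A u v K0.
  by exists N => //; exists n0 => n nn; rewrite !E P.
have [N N0 [n0 P]] := eventually_periodic_family H.
by exists N => //; exists n0 => n nn; apply: rank_eq_minors => k; exact: P.
Qed.

(** Membership in a row space is a rank condition: appending w must not raise the rank. *)
Lemma eventually_periodic_submx (K : fieldType) m p q r (sigma : 'M[K]_m)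
    (L : 'M_(p, m)) (G : 'M_(q, m)) (w : 'M_(r, m)) : [pchar K] =i pred0 ->
  eventually_periodic (fun n => (w <= L *m sigma ^+ n + G)%MS).
Proof.
move=> K0.
have E n : (w <= L *m sigma ^+ n + G)%MS =
    (\rank (col_mx (L *m sigma ^+ n) G) == \rank (col_mx (L *m sigma ^+ n) (col_mx G w))).
  have [|_ ->] := @mxrank_leqif_sup _ _ _ _ (col_mx (L *m sigma ^+ n) G)
    (col_mx (L *m sigma ^+ n) (col_mx G w)).
    by rewrite -!addsmxE addsmxS // -addsmxE addsmxSl.
  by rewrite !col_mx_sub -!addsmxE addsmxSl addsmxSr.
have [N1 N10 [n1 H1]] := eventually_periodic_rank sigma L G K0.
have [N2 N20 [n2 H2]] := eventually_periodic_rank sigma L (col_mx G w) K0.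
have iter (f : nat -> nat) N n0 k n : (forall n, (n0 <= n)%N -> f (n + N)%N = f n) ->
    (n0 <= n)%N -> f (n + k * N)%N = f n.
  move=> Hf nn; elim: k => [|k IH]; first by rewrite addn0.
  by rewrite mulSn addnCA addnC Hf ?IH // (leq_trans nn) ?leq_addr.
exists (N1 * N2)%N; first by rewrite muln_gt0 N10.
exists (maxn n1 n2) => n; rewrite geq_max => /andP[nn1 nn2]; rewrite !E.
congr (_ == _).
  by rewrite mulnC (iter (fun n => \rank (col_mx (L *m sigma ^+ n) G)) _ _ _ _ H1).
by rewrite (iter (fun n => \rank (col_mx (L *m sigma ^+ n) (col_mx G w))) _ _ _ _ H2).
Qed.

(** The projection whose row space consists of the vectors vanishing at all indices up to and
    including j. *)
Definition tail_mx (K : fieldType) m (j : 'I_m) : 'M[K]_m :=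
  \matrix_(i, k) ((i == k) && (j < i)%N)%:R.

(* j is the index of the first nonzero coordinate of some vector of U. *)
Definition leading_index (K : fieldType) m p (U : 'M[K]_(p, m)) (j : 'I_m) : bool :=
  ((delta_mx 0 j : 'rV_m) <= U + tail_mx K j)%MS.

Lemma mul_tail_mx (K : fieldType) m (j : 'I_m) (t : 'rV[K]_m) k :
  (t *m tail_mx K j) 0 k = t 0 k * (j < k)%N%:R.
Proof.
rewrite mxE (bigD1 k) //= mxE eqxx /= big1 ?addr0 // => i ik.
by rewrite mxE (negPf ik) mulr0.
Qed.

Lemma leading_indexP (K : fieldType) m p (U : 'M[K]_(p, m)) (j : 'I_m) :
  reflect (exists u : 'rV_m, [/\ (u <= U)%MS, u 0 j != 0 &
             forall i : 'I_m, (i < j)%N -> u 0 i = 0])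
          (leading_index U j).
Proof.
apply: (iffP idP) => [/sub_addsmxP[[x y] /= e]|[u [uU uj ui]]].
  have xU i : (x *m U) 0 i = (i == j)%:R - y 0 i * (j < i)%N%:R.
    by rewrite -mul_tail_mx; have /rowP/(_ i) := e; rewrite mxE eqxx /= => ->; rewrite [in RHS]mxE addrK.
  exists (x *m U); split; first exact: submxMl.
    by rewrite xU eqxx ltnn mulr0 subr0 oner_eq0.
  by move=> i ij; rewrite xU ltnNge (ltnW ij) mulr0 subr0 -val_eqE /= ltn_eqF.
pose t := u - u 0 j *: delta_mx 0 j.
have tE : t = t *m tail_mx K j.
  apply/rowP=> i; rewrite mul_tail_mx !mxE eqxx /=.
  case: (ltngtP i j) => [ij|ij|/val_inj ->]; rewrite ?mulr1 ?mulr0 //.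
    by rewrite ui // -val_eqE /= ltn_eqF // mulr0 subr0.
  by rewrite eqxx mulr1 subrr.
rewrite /leading_index; have -> : delta_mx 0 j = (u 0 j)^-1 *: (u - t).
  by rewrite /t opprB addrC subrK scalerA mulVf // scale1r.
apply: scalemx_sub; apply: addmx_sub; first exact: submx_trans uU (addsmxSl _ _).
by rewrite eqmx_opp tE; apply: submx_trans (addsmxSr _ _); exact: submxMl.
Qed.

(** * The free algebra and the ideal of relations *)

HB.instance Definition _ m := Countable.copy (gen m) (pcan_type (@gen_encK m)).

Definition gen_enum m : seq (gen m) := [:: Ga; Gb; Gc] ++ [seq GX i | i <- enum 'I_m].

Lemma gen_enumP m : Finite.axiom (@gen_enum m).
Proof.
have injX : injective (@GX m) by move=> i j [].
apply: Finite.uniq_enumP.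
  rewrite cat_uniq map_inj_uniq ?enum_uniq // andbT /=.
  by apply/hasPn => _ /mapP[i _ ->].
by case=> [i|||] //; rewrite mem_cat (map_f (@GX m)) ?orbT // mem_enum.
Qed.
HB.instance Definition _ m := isFinite.Build (gen m) (@gen_enumP m).

Section FreeAlgebra.
Variables (K : fieldType) (m : nat).
Implicit Types (u v w : word m) (f g : fpoly K m).

Lemma pmul_sumr (I : finType) (c : I -> K) (F : I -> fpoly K m) g :
  pmul g (fun w => \sum_i c i * F i w) = (fun w => \sum_i c i * pmul g (F i) w).
Proof.
apply: funext => w; rewrite /pmul.
under [RHS]eq_bigr do rewrite mulr_sumr.
rewrite [RHS]exchange_big; apply: eq_bigr => k _; rewrite mulr_sumr.
by apply: eq_bigr => i _; rewrite mulrCA.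
Qed.

Lemma pmul_suml (I : finType) (c : I -> K) (F : I -> fpoly K m) g :
  pmul (fun w => \sum_i c i * F i w) g = (fun w => \sum_i c i * pmul (F i) g w).
Proof.
apply: funext => w; rewrite /pmul.
under [RHS]eq_bigr do rewrite mulr_sumr.
rewrite [RHS]exchange_big; apply: eq_bigr => k _; rewrite mulr_suml.
by apply: eq_bigr => i _; rewrite mulrA.
Qed.

Lemma pmul_mono u v : pmul (mono K u) (mono K v) = mono K (u ++ v).
Proof.
apply: funext => w; rewrite /pmul /mono.
have [->|wuv] := eqVneq w (u ++ v).
  have su : (size u < (size (u ++ v)).+1)%N by rewrite ltnS size_cat leq_addr.
  rewrite (bigD1 (Ordinal su)) //= take_size_cat // drop_size_cat // !eqxx mulr1.
  rewrite big1 ?addr0 // => i iu.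
  case: eqP => [e|]; last by rewrite mul0r.
  case/eqP: iu; apply: val_inj => /=.
  by have := congr1 size e; rewrite size_takel // -ltnS.
rewrite big1 // => i _; case: eqP => [eu|]; last by rewrite mul0r.
case: eqP => [ev|]; last by rewrite mulr0.
by case/eqP: wuv; rewrite -eu -ev cat_take_drop.
Qed.

Lemma pmul_sandwich (I : finType) (c : I -> K) (q : I -> word m) u v :
  pmul (pmul (mono K u) (fun w => \sum_i c i * mono K (q i) w)) (mono K v) =
  (fun w => \sum_i c i * mono K (u ++ q i ++ v) w).
Proof.
rewrite pmul_sumr pmul_suml; apply: funext => w; apply: eq_bigr => i _.
by rewrite !pmul_mono catA.
Qed.

Lemma mono_sum u : mono K u = (fun w => \sum_(i < 1) 1 * mono K u w).
Proof. by apply: funext => w; rewrite big_ord1 mul1r. Qed.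

(** The commutation relation as one indexed sum, ready for [pmul_sandwich]: [None] stands for the
    word x_i c and [Some j] for c x_j. *)
Lemma xc_sum (sigma : 'M[K]_m) i :
  padd (mono K [:: GX i; Gc]) (pscale (-1) (vec_poly (row i sigma) [:: Gc] [::])) =
  (fun w => \sum_(o : option 'I_m) (if o is Some j then - sigma i j else 1) *
     mono K (if o is Some j then [:: Gc; GX j] else [:: GX i; Gc]) w).
Proof.
apply: funext => w; rewrite /padd /pscale /vec_poly.
rewrite (bigD1 None) //= mul1r; congr (_ + _).
rewrite (reindex_omap Some id) /=; last by case.
rewrite mulr_sumr; apply: eq_big => [j|j _]; first by rewrite eqxx.
by rewrite mxE mulrA mulN1r.
Qed.

Lemma vec_poly_at (x : 'rV[K]_m) u v j : vec_poly x u v (u ++ GX j :: v) = x 0 j.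
Proof.
rewrite /vec_poly (bigD1 j) //= /mono eqxx mulr1 big1 ?addr0 // => i ij.
rewrite eqseq_cat // eqxx /= eqseq_cons.
case: eqP => [[e]|]; last by rewrite mulr0.
by rewrite e eqxx in ij.
Qed.

Lemma vec_poly_supp (x : 'rV[K]_m) u v w : vec_poly x u v w != 0 ->
  exists2 j, x 0 j != 0 & w = u ++ GX j :: v.
Proof.
move=> h; apply: contrapT => H; case/eqP: h; rewrite /vec_poly big1 // => j _.
rewrite /mono; case: eqP => [e|]; last by rewrite mulr0.
by apply/eqP; rewrite mulr1; apply/negPn/negP => xj; apply: H; exists j.
Qed.

Lemma vec_poly_sandwich (x : 'rV[K]_m) u v p q :
  pmul (pmul (mono K p) (vec_poly x u v)) (mono K q) = vec_poly x (p ++ u) (v ++ q).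
Proof. by rewrite pmul_sandwich; apply: funext => w; apply: eq_bigr => j _; rewrite -!catA. Qed.

Lemma lex_lt_cat u v w : lex_lt (u ++ v) (u ++ w) = lex_lt v w.
Proof. by elim: u => //= y u ->; rewrite ltnn eqxx. Qed.

Lemma lex_ltnn u : lex_lt u u = false.
Proof. by elim: u => //= y u ->; rewrite ltnn andbF. Qed.

Lemma lex_lt_GX (i j : 'I_m) u v : lex_lt (GX i :: u) (GX j :: v) =
  (j < i)%N || (i == j) && lex_lt u v.
Proof.
rewrite /= (_ : (_ < _)%N = (j < i)%N).
  by congr (_ || (_ && _)); apply/eqP/eqP => [[]|->].
by have := ltn_ord i; have := ltn_ord j; lia.
Qed.

Variables (L R sigma : 'M[K]_m).
Local Notation ideal := (in_ideal L R sigma).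

Lemma ideal_gen u v r : rel_A L R sigma r -> ideal (pmul (pmul (mono K u) r) (mono K v)).
Proof.
move=> rA; exists 1%N, (fun=> 1), (fun=> u), (fun=> v), (fun=> r); split=> // w.
by rewrite big_ord1 mul1r.
Qed.

Lemma idealD f g : ideal f -> ideal g -> ideal (fun w => f w + g w).
Proof.
move=> [n1 [c1 [u1 [v1 [r1 [h1 e1]]]]]] [n2 [c2 [u2 [v2 [r2 [h2 e2]]]]]].
pose pick T (a : 'I_n1 -> T) (b : 'I_n2 -> T) (k : 'I_(n1 + n2)) :=
  match split k with inl i => a i | inr i => b i end.
have pl T (a : 'I_n1 -> T) b i : pick T a b (lshift n2 i) = a i.
  by rewrite /pick; case: split_ordP => j /eqP; rewrite ?eq_shift // => /eqP ->.
have pr T (a : 'I_n1 -> T) b i : pick T a b (rshift n1 i) = b i.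
  by rewrite /pick; case: split_ordP => j /eqP; rewrite ?eq_shift // => /eqP ->.
exists (n1 + n2)%N, (pick _ c1 c2), (pick _ u1 u2), (pick _ v1 v2), (pick _ r1 r2).
split=> [k|w]; first by rewrite /pick; case: split.
rewrite big_split_ord e1 e2 /=; congr (_ + _); apply: eq_bigr => i _; by rewrite ?pl ?pr.
Qed.

Lemma idealZ a f : ideal f -> ideal (fun w => a * f w).
Proof.
move=> [n [c [u [v [r [h e]]]]]]; exists n, (fun k => a * c k), u, v, r; split=> // w.
by rewrite e mulr_sumr; apply: eq_bigr => i _; rewrite mulrA.
Qed.

Lemma ideal0 : ideal (fun=> 0).
Proof.
have nf : 'I_0 -> False by case.
exists 0%N, (fun=> 0), (fun=> [::]), (fun=> [::]), (fun=> fun=> 0).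
by split=> [k|w]; [case: (nf k)|rewrite big_ord0].
Qed.

Lemma ideal_sum (I : finType) (c : I -> K) (F : I -> fpoly K m) :
  (forall i, ideal (F i)) -> ideal (fun w => \sum_i c i * F i w).
Proof.
move=> FI; rewrite /index_enum; elim: (Finite.enum I) => [|i r IH].
  by have := ideal0; congr ideal; apply: funext => w; rewrite big_nil.
have := idealD (idealZ (c i) (FI i)) IH.
by congr ideal; apply: funext => w; rewrite big_cons.
Qed.

Definition form p := word m -> 'rV[K]_p.

(** Linear extension of g cut down to words of length N, which makes the sum finite whatever the
    support of f. *)
Definition extend N p (g : form p) f : 'rV[K]_p := \sum_(t : N.-tuple (gen m)) f t *: g t.

Lemma extend_sum N p (g : form p) (I : finType) (c : I -> K) (F : I -> fpoly K m) :
  extend N g (fun w => \sum_i c i * F i w) = \sum_i c i *: extend N g (F i).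
Proof.
rewrite /extend; under [RHS]eq_bigr do rewrite scaler_sumr.
rewrite [RHS]exchange_big; apply: eq_bigr => t _; rewrite scaler_suml.
by apply: eq_bigr => i _; rewrite scalerA.
Qed.

Lemma extend_mono N p (g : form p) u : (forall w, size w != N -> g w = 0) ->
  extend N g (mono K u) = g u.
Proof.
move=> gN; rewrite /extend /mono.
have [/eqP su|su] := boolP (size u == N); last first.
  rewrite gN // big1 // => t _; case: eqP => [e|]; last by rewrite scale0r.
  by case/eqP: su; rewrite -e size_tuple.
have su' : size u == N by rewrite su.
rewrite (bigD1 (Tuple su')) //= eqxx scale1r big1 ?addr0 // => t tu.
case: eqP => [e|]; last by rewrite scale0r.
by case/eqP: tu; apply: val_inj.
Qed.

(** An ideal element is a combination of products u r v, so g need only be tested there. Monomial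
    and commutation relations must go to 0, while those from L and R may take values in U. *)
Lemma extend_ideal N p q (g : form p) (U : 'M[K]_(q, p)) :
  (forall w, size w != N -> g w = 0) ->
  (forall u v i j, g (u ++ [:: GX i; GX j] ++ v) = 0) ->
  (forall u v y, g (u ++ [:: y; Ga] ++ v) = 0) ->
  (forall u v y, g (u ++ [:: Gb; y] ++ v) = 0) ->
  (forall u v (l : 'rV_m), (l <= L)%MS ->
     ((\sum_j l 0 j *: g (u ++ [:: Ga; GX j] ++ v))%R <= U)%MS) ->
  (forall u v (l : 'rV_m), (l <= R)%MS ->
     ((\sum_j l 0 j *: g (u ++ [:: GX j; Gb] ++ v))%R <= U)%MS) ->
  (forall u v i,
     g (u ++ [:: GX i; Gc] ++ v) = \sum_j sigma i j *: g (u ++ [:: Gc; GX j] ++ v)) ->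
  forall f, ideal f -> (extend N g f <= U)%MS.
Proof.
move=> gN gxx gya gby gaL gRb gxc f [n [c [u [v [r [rA fE]]]]]].
have -> : f = (fun w => \sum_k c k * pmul (pmul (mono K (u k)) (r k)) (mono K (v k)) w).
  exact: funext.
rewrite extend_sum; apply: summx_sub => k _; apply: scalemx_sub.
have gen_sum (I : finType) (d : I -> K) (q' : I -> word m) :
    extend N g (pmul (pmul (mono K (u k)) (fun w => \sum_i d i * mono K (q' i) w)) (mono K (v k))) =
    \sum_i d i *: g (u k ++ q' i ++ v k).
  rewrite pmul_sandwich extend_sum; apply: eq_bigr => i _.
  by rewrite extend_mono.
case: (rA k) => [i j|y|y|l lL|l lR|i].
- by rewrite [mono K [:: _; _]]mono_sum gen_sum big1 ?sub0mx // => o _; rewrite gxx scaler0.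
- by rewrite [mono K [:: _; _]]mono_sum gen_sum big1 ?sub0mx // => o _; rewrite gya scaler0.
- by rewrite [mono K [:: _; _]]mono_sum gen_sum big1 ?sub0mx // => o _; rewrite gby scaler0.
- by rewrite gen_sum; exact: gaL.
- by rewrite gen_sum; exact: gRb.
rewrite xc_sum gen_sum (bigD1 None) //= scale1r gxc.
rewrite (reindex_omap Some id) /=; last by case.
rewrite [X in (_ + X)](eq_big xpredT (fun j => - (sigma i j *: g (u k ++ [:: Gc; GX j] ++ v k)))).
- by rewrite sumrN subrr sub0mx.
- by move=> j; rewrite eqxx.
by move=> j _; rewrite scaleNr.
Qed.

End FreeAlgebra.

(** * Normal words *)

(* A state (alpha, n, o, beta) stands for the word or element
   a^alpha c^n o b^beta, and None for zero. *)
Definition state (X : Type) : Type := option (bool * nat * option X * bool).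

(** Right multiplication of a state by a generator: [ins] is what x_i contributes and [shift] the
    effect of c on it. With indices and no shift it recognises reduced words; with vectors and sigma
    it evaluates words. *)
Definition step m X (ins : 'I_m -> X) (shift : X -> option X) (s : state X) (y : gen m) : state X :=
  match s with
  | Some (alpha, n, o, false) =>
      match y with
      | Ga => if s is Some (false, 0%N, None, false) then Some (true, 0%N, None, false) else None
      | Gb => Some (alpha, n, o, true)
      | Gc => match o with
              | None => Some (alpha, n.+1, None, false)
              | Some x => if shift x is Some x' then Some (alpha, n.+1, Some x', false) else None
              end
      | GX i => if o is None then Some (alpha, n, Some (ins i), false) else None
      end
  | _ => None
  end.

Definition init_state X : state X := Some (false, 0%N, None, false).

Section Run.
Variables (m : nat) (X : Type) (ins : 'I_m -> X) (shift : X -> option X).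
Local Notation stp := (step ins shift).
Local Notation run := (foldl stp (init_state X)).

Lemma run_None (w : word m) : foldl stp None w = None.
Proof. by elim: w. Qed.

Definition prefix_word (alpha : bool) n : word m := nseq alpha Ga ++ nseq n Gc.

Lemma rcons_prefix alpha n : rcons (prefix_word alpha n) Gc = prefix_word alpha n.+1.
Proof. by rewrite /prefix_word rcons_cat -cats1 -(nseqD _ 1) addn1. Qed.

Lemma run_no_x w alpha n (beta : bool) : run w = Some (alpha, n, None, beta) ->
  w = prefix_word alpha n ++ nseq beta Gb.
Proof.
elim/last_ind: w alpha n beta => [|w y IH] alpha n beta; first by case=> <- <- <-.
rewrite foldl_rcons; case E : (run w) => [[[[a' n'] [x|]] [|]]|] //=; case: y => //=.
- by case: a' n' {E} => [] [].
- by case: (shift x).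
- by case: a' n' E => [] [] // /IH -> [<- <- <-].
- by case=> <- <- <-; rewrite (IH _ _ _ E) cats0 cats1.
- by case=> <- <- <-; rewrite (IH _ _ _ E) !cats0 rcons_prefix.
Qed.

Lemma run_prefix alpha n : run (prefix_word alpha n) = Some (alpha, n, None, false).
Proof.
elim: n => [|n IH]; first by case: alpha.
by rewrite -rcons_prefix foldl_rcons IH.
Qed.

End Run.

Definition nf_step m := @step m 'I_m id (fun=> None).
Definition nf_run m (w : word m) : state 'I_m := foldl (@nf_step m) (init_state 'I_m) w.

Definition x_word m (alpha : bool) n (j : 'I_m) (beta : bool) : word m :=
  prefix_word m alpha n ++ GX j :: nseq beta Gb.

Lemma nf_run_x m (w : word m) alpha n j beta :
  nf_run w = Some (alpha, n, Some j, beta) -> w = x_word alpha n j beta.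
Proof.
elim/last_ind: w alpha n j beta => [|w y IH] alpha n j beta //.
rewrite /nf_run foldl_rcons -/(nf_run w).
case E : (nf_run w) => [[[[a' n'] [x|]] [|]]|] //=; case: y => //=.
- by case: a' n' {E} => [] [].
- by case=> <- <- <- <-; rewrite (IH _ _ _ _ E) /x_word rcons_cat.
- move=> i [<- <- <- <-]; have := run_no_x E; rewrite cats0 => ->.
  by rewrite /x_word cats1.
- by case: a' n' {E} => [] [].
Qed.

Section Normal.
Variables (K : fieldType) (m : nat) (L R sigma : 'M[K]_m).
Local Notation normal := (normal_word L R sigma).
Local Notation ideal := (in_ideal L R sigma).

(** Evaluation modulo all relations except those coming from L and R. *)
Definition ev_step := @step m 'rV[K]_m (fun i => delta_mx 0 i) (fun x => Some (x *m sigma)).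
Local Notation ev := (foldl ev_step (init_state 'rV[K]_m)).

Lemma ev_x w alpha n x beta : ev w = Some (alpha, n, Some x, beta) ->
  exists k i l, [/\ w = prefix_word m alpha k ++ GX i :: nseq l Gc ++ nseq beta Gb,
     n = (k + l)%N & x = delta_mx 0 i *m sigma ^+ l].
Proof.
elim/last_ind: w alpha n x beta => [|w y IH] alpha n x beta //.
rewrite foldl_rcons; case E : (ev w) => [[[[a' n'] [z|]] [|]]|] //=; case: y => //=.
- by case: a' n' {E} => [] [].
- case=> <- <- <- <-; have [k [i [l [-> -> ->]]]] := IH _ _ _ _ E.
  by exists k, i, l; rewrite cats0 -cats1 -!catA.
- case=> <- <- <- <-; have [k [i [l [-> -> ->]]]] := IH _ _ _ _ E.
  exists k, i, l.+1; rewrite !cats0 addnS exprSr -mulmxE mulmxA; split=> //.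
  by rewrite rcons_cat /= -cats1 -(nseqD _ 1) addn1.
- move=> i [<- <- <- <-]; have := run_no_x E; rewrite cats0 => ->.
  by exists n', i, 0%N; rewrite addn0 expr0 mulmx1 /= cats1.
- by case: a' n' {E} => [] [].
Qed.

Lemma ev_size w alpha n o beta : ev w = Some (alpha, n, o, beta) ->
  size w = (alpha + n + isSome o + beta)%N.
Proof.
case: o => [x /ev_x[k [i [l [-> -> _]]]]|/run_no_x ->].
  by rewrite /prefix_word !size_cat /= !size_cat !size_nseq; lia.
by rewrite /prefix_word !size_cat !size_nseq /= addn0.
Qed.

(** Once a vector is present, the course of the run does not depend on it: v either kills it or
    applies a power of sigma. Linear relations between vectors therefore survive multiplication by v
    on the right. *)
Lemma ev_linear v alpha n beta :
  (forall x, foldl ev_step (Some (alpha, n, Some x, beta)) v = None) \/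
  exists l beta', forall x, foldl ev_step (Some (alpha, n, Some x, beta)) v =
    Some (alpha, (n + l)%N, Some (x *m sigma ^+ l), beta').
Proof.
elim: v n beta => [|y v IH] n beta.
  by right; exists 0%N, beta => x; rewrite addn0 expr0 mulmx1.
case: beta => /=; first by left=> x; exact: run_None.
case: y => [i|||] /=.
- by left=> x; exact: run_None.
- by left=> x; case: alpha n {IH} => [] [|n]; exact: run_None.
- exact: IH.
case: (IH n.+1 false) => [H|[l [b' H]]]; first by left.
right; exists l.+1, b' => x; rewrite H addnS addSn; congr (Some (_, _, Some _, _)).
by rewrite exprS -mulmxE mulmxA.
Qed.

Lemma ev_xx u v i j : ev (u ++ [:: GX i; GX j] ++ v) = None.
Proof.
rewrite !foldl_cat /=; set s := ev u; rewrite (_ : ev_step _ _ = None) ?run_None //.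
by case: s => [[[[a n] [x|]] [|]]|].
Qed.

Lemma ev_ya u v y : ev (u ++ [:: y; Ga] ++ v) = None.
Proof.
rewrite !foldl_cat /=; set s := ev u; rewrite (_ : ev_step _ Ga = None) ?run_None //.
by case: s => [[[[[|] [|n]] [x|]] [|]]|]; case: y.
Qed.

Lemma ev_by u v y : ev (u ++ [:: Gb; y] ++ v) = None.
Proof.
rewrite !foldl_cat /=; set s := ev u; rewrite (_ : ev_step _ y = None) ?run_None //.
by case: s => [[[[a n] [x|]] [|]]|].
Qed.

Lemma ev_ax u v : (forall j, ev (u ++ [:: Ga; GX j] ++ v) = None) \/
  exists l beta', forall j, ev (u ++ [:: Ga; GX j] ++ v) =
    Some (true, l, Some (delta_mx 0 j *m sigma ^+ l), beta').
Proof.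
case E : (ev u) => [[[[[|] [|n]] [x|]] [|]]|];
  try by left=> j; rewrite !foldl_cat E /=; exact: run_None.
case: (ev_linear v true 0 false) => [H|[l [b' H]]].
  by left=> j; rewrite !foldl_cat E /= H.
by right; exists l, b' => j; rewrite !foldl_cat E /= H.
Qed.

Lemma ev_xb u v : (forall j, ev (u ++ [:: GX j; Gb] ++ v) = None) \/
  exists alpha n, forall j, ev (u ++ [:: GX j; Gb] ++ v) =
    Some (alpha, n, Some (delta_mx 0 j), true).
Proof.
case E : (ev u) => [[[[a n] [x|]] [|]]|];
  try by left=> j; rewrite !foldl_cat E /=; exact: run_None.
case: v => [|y v]; last by left=> j; rewrite !foldl_cat E /=; exact: run_None.
by right; exists a, n => j; rewrite !foldl_cat E.
Qed.

Lemma ev_xc u v :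
  (forall i, ev (u ++ [:: GX i; Gc] ++ v) = None /\ ev (u ++ [:: Gc; GX i] ++ v) = None) \/
  exists alpha n l beta, forall i,
    ev (u ++ [:: GX i; Gc] ++ v) =
      Some (alpha, n, Some (delta_mx 0 i *m sigma *m sigma ^+ l), beta) /\
    ev (u ++ [:: Gc; GX i] ++ v) = Some (alpha, n, Some (delta_mx 0 i *m sigma ^+ l), beta).
Proof.
case E : (ev u) => [[[[a n] [x|]] [|]]|];
  try by left=> j; rewrite !foldl_cat E /= !run_None.
case: (ev_linear v a n.+1 false) => [H|[l [b' H]]].
  by left=> i; rewrite !foldl_cat E /= !H.
by right; exists a, (n.+1 + l)%N, l, b' => i; rewrite !foldl_cat E /= !H.
Qed.

Definition ev_space (alpha : bool) n (beta : bool) : 'M[K]_m :=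
  ((if alpha then L else 0) *m sigma ^+ n + (if beta then R else 0))%MS.

Definition x_form (alpha : bool) n (beta : bool) : form K m m := fun w =>
  if ev w is Some (alpha', n', Some x, beta') then
    if (alpha', n', beta') == (alpha, n, beta) then x else 0
  else 0.

(** Only the relations from L and R are not respected by [ev]; on them the component read by
    [x_form] falls into L sigma^n or R. *)
Lemma x_form_ideal (alpha : bool) n (beta : bool) f : ideal f ->
  (extend (alpha + n + 1 + beta) (x_form alpha n beta) f <= ev_space alpha n beta)%MS.
Proof.
apply: extend_ideal.
- move=> w sw; rewrite /x_form; case E : (ev w) => [[[[a' n'] [x|]] b']|] //.
  by case: eqP => // -[ea en eb]; case/eqP: sw; rewrite (ev_size E) ea en eb.
- by move=> u v i j; rewrite /x_form ev_xx.
- by move=> u v y; rewrite /x_form ev_ya.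
- by move=> u v y; rewrite /x_form ev_by.
- move=> u v l lL; rewrite /x_form; case: (ev_ax u v) => [H|[k [b' H]]].
    by rewrite big1 ?sub0mx // => j _; rewrite H scaler0.
  under eq_bigr do rewrite H.
  case: eqP => [[<- <- _]|_]; last by rewrite big1 ?sub0mx // => j _; rewrite scaler0.
  under eq_bigr do rewrite scalemxAl.
  rewrite -mulmx_suml -row_sum_delta /ev_space; apply: submx_trans (addsmxSl _ _).
  exact: submxMr.
- move=> u v l lR; rewrite /x_form; case: (ev_xb u v) => [H|[a' [k H]]].
    by rewrite big1 ?sub0mx // => j _; rewrite H scaler0.
  under eq_bigr do rewrite H.
  case: eqP => [[_ _ <-]|_]; last by rewrite big1 ?sub0mx // => j _; rewrite scaler0.
  by rewrite -row_sum_delta /ev_space; apply: submx_trans (addsmxSr _ _).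
move=> u v i; rewrite /x_form; case: (ev_xc u v) => [H|[a' [k [l [b' H]]]]].
  by rewrite (H i).1 big1 // => j _; rewrite (H j).2 scaler0.
rewrite (H i).1; under eq_bigr do rewrite (H _).2.
case: eqP => _; last by rewrite big1 // => j _; rewrite scaler0.
under eq_bigr do rewrite scalemxAl.
rewrite -mulmx_suml -rowE; congr (_ *m _).
by rewrite [LHS]row_sum_delta; apply: eq_bigr => j _; rewrite mxE.
Qed.

(** The indicator function of w kills the ideal: every word occurring in a product u r v evaluates
    to zero or to a state containing a vector, so it differs from w. *)
Lemma no_x_normal alpha n (beta : bool) : normal (prefix_word m alpha n ++ nseq beta Gb).
Proof.
set w := _ ++ _; case=> f [fI [fw _]].
have evw : ev w = Some (alpha, n, None, beta).
  by rewrite foldl_cat run_prefix; case: (beta).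
pose g : form K m 1 := fun t => (t == w)%:R%:M.
have g0 t : ev t <> Some (alpha, n, None, beta) -> g t = 0.
  by move=> h; rewrite /g; case: eqP => [e|_]; [case: h; rewrite e|rewrite raddf0].
have gw : extend (size w) g f = (f w)%:M.
  rewrite /extend (bigD1 (in_tuple w)) //= big1 ?addr0.
    by rewrite /g eqxx scale_scalar_mx mulr1.
  move=> t tw; rewrite /g; case: eqP => [e|_]; last by rewrite raddf0 scaler0.
  by case/eqP: tw; apply: val_inj.
have : (extend (size w) g f <= (0 : 'M[K]_1))%MS.
  apply: extend_ideal fI.
  - move=> t st; rewrite /g; have [e|_] := eqVneq t w; last by rewrite raddf0.
    by rewrite e eqxx in st.
  - by move=> u v i j; apply: g0; rewrite ev_xx.
  - by move=> u v y; apply: g0; rewrite ev_ya.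
  - by move=> u v y; apply: g0; rewrite ev_by.
  - move=> u v l _; rewrite big1 ?sub0mx // => j _; rewrite g0 ?scaler0 //.
    by case: (ev_ax u v) => [->|[k [b' ->]]].
  - move=> u v l _; rewrite big1 ?sub0mx // => j _; rewrite g0 ?scaler0 //.
    by case: (ev_xb u v) => [->|[k [b' ->]]].
  move=> u v i; rewrite big1 ?g0 // => [|j _]; last rewrite g0 ?scaler0 //.
    by case: (ev_xc u v) => [/(_ i)[->]|[a' [k [l [b' /(_ i)[->]]]]]].
  by case: (ev_xc u v) => [/(_ j)[_ ->]|[a' [k [l [b' /(_ j)[_ ->]]]]]].
rewrite gw submx0 => /eqP/matrixP/(_ 0 0); rewrite !mxE mulr1n => e.
by rewrite e eqxx in fw.
Qed.

Lemma x_word_leading alpha n j (beta : bool) : ~ normal (x_word alpha n j beta) ->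
  leading_index (ev_space alpha n beta) j.
Proof.
move/contrapT=> [f [fI [fw fmax]]]; set w := x_word _ _ _ _ in fw fmax.
have evw : ev w = Some (alpha, n, Some (delta_mx 0 j), beta).
  by rewrite foldl_cat run_prefix; case: (beta).
have sw : size w == (alpha + n + 1 + beta)%N by rewrite (ev_size evw).
have xw : x_form alpha n beta w = delta_mx 0 j by rewrite /x_form evw eqxx.
(* A word below w with the same alpha, n and beta cannot have its x earlier, since x > c; so its x
   is at the same place with an index above j, and it contributes nothing to coordinates up to j. *)
have small (t : (alpha + n + 1 + beta).-tuple (gen m)) (i : 'I_m) :
    t != Tuple sw -> (i <= j)%N -> f t * x_form alpha n beta t 0 i = 0.
  move=> tw ij; have [->|ft] := eqVneq (f t) 0; first by rewrite mul0r.
  have /orP[/eqP e|] := fmax _ ft; first by case/eqP: tw; apply: val_inj.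
  rewrite /deglex_lt (eqP sw) size_tuple ltnn eqxx /= => lt_tw.
  rewrite /x_form; case E : (ev t) => [[[[a' n'] [x|]] b']|]; rewrite ?mxE ?mulr0 //.
  case: eqP => [[ea en eb]|_]; last by rewrite mxE mulr0.
  move: E; rewrite ea en eb => /ev_x[k [i0 [[|l] [et ek ->]]]].
    move: lt_tw; rewrite et /w /x_word ek addn0 -[nseq 0 Gc ++ _]/(nseq beta Gb) lex_lt_cat lex_lt_GX lex_ltnn andbF orbF => ji.
    by rewrite expr0 mulmx1 mxE eqxx /= -val_eqE /= ltn_eqF ?mulr0 // (leq_ltn_trans ij).
  by move: lt_tw; rewrite et /w /x_word ek /prefix_word nseqD -!catA !lex_lt_cat.
apply/leading_indexP; exists (extend (alpha + n + 1 + beta) (x_form alpha n beta) f).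
have ext (i : 'I_m) : (i <= j)%N -> extend (alpha + n + 1 + beta) (x_form alpha n beta) f 0 i =
    f w * (i == j)%:R.
  move=> ij; rewrite /extend summxE (bigD1 (Tuple sw)) //= big1 ?addr0.
    by rewrite xw !mxE eqxx.
  by move=> t tw; rewrite mxE small.
split; first exact: x_form_ideal.
  by rewrite ext // eqxx mulr1.
move=> i ij; have /negPf inj : i != j by rewrite -val_eqE ltn_eqF.
by rewrite ext ?inj ?mulr0 // ltnW.
Qed.

(** Subtracting the commutation relations with the coordinates of x as coefficients trades x c for c
    sigma(x). *)
Lemma vec_poly_shift (x : 'rV[K]_m) p q : ideal (vec_poly x p (Gc :: q)) ->
  ideal (vec_poly (x *m sigma) (rcons p Gc) q).
Proof.
move=> xI; pose F i := pmul (pmul (mono K p) (padd (mono K [:: GX i; Gc])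
  (pscale (-1) (vec_poly (row i sigma) [:: Gc] [::])))) (mono K q).
have FI i : ideal (F i) by apply: ideal_gen; constructor.
have FE i w : F i w = mono K (p ++ GX i :: Gc :: q) w -
    \sum_j sigma i j * mono K (rcons p Gc ++ GX j :: q) w.
  rewrite /F xc_sum pmul_sandwich (bigD1 None) //= mul1r; congr (_ + _).
  rewrite (reindex_omap Some id) /=; last by case.
  rewrite -sumrN; apply: eq_big => [j|j _]; first by rewrite eqxx.
  by rewrite mulNr cat_rcons.
have := idealD xI (idealZ (-1) (ideal_sum (fun i => x 0 i) FI)).
congr ideal; apply: funext => w; rewrite /vec_poly mulN1r -sumrB.
under eq_bigr do rewrite FE mulrBr opprB addrC subrK mulr_sumr.
rewrite exchange_big; apply: eq_bigr => j _; rewrite mxE mulr_suml.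
by apply: eq_bigr => i _; rewrite mulrA.
Qed.

Lemma vec_polyL (l : 'rV[K]_m) n q : (l <= L)%MS ->
  ideal (vec_poly (l *m sigma ^+ n) (prefix_word m true n) q).
Proof.
move=> lL; elim: n q => [|n IH] q.
  rewrite expr0 mulmx1; have := ideal_gen [::] q (rel_aL R sigma lL).
  by rewrite vec_poly_sandwich.
by rewrite exprSr -mulmxE mulmxA -rcons_prefix; apply: vec_poly_shift.
Qed.

Lemma vec_poly_ideal u alpha n (beta : bool) : (u <= ev_space alpha n beta)%MS ->
  ideal (vec_poly u (prefix_word m alpha n) (nseq beta Gb)).
Proof.
case/sub_addsmxP=> -[x y] /= ->.
have vec0 p q : ideal (vec_poly 0 p q).
  have := @ideal0 K m L R sigma; congr ideal; apply: funext => w.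
  by rewrite /vec_poly big1 // => i _; rewrite mxE mul0r.
have I1 : ideal (vec_poly (x *m ((if alpha then L else 0) *m sigma ^+ n))
    (prefix_word m alpha n) (nseq beta Gb)).
  case: alpha; last by rewrite mul0mx mulmx0.
  by rewrite mulmxA; apply: vec_polyL; exact: submxMl.
have I2 : ideal (vec_poly (y *m (if beta then R else 0)) (prefix_word m alpha n) (nseq beta Gb)).
  case: beta {I1}; last by rewrite mulmx0.
  have := ideal_gen (prefix_word m alpha n) [::] (rel_Rb L sigma (submxMl y R)).
  by rewrite vec_poly_sandwich cats0.
have := idealD I1 I2; congr ideal; apply: funext => w.
by rewrite /vec_poly -big_split; apply: eq_bigr => i _; rewrite /= !mxE mulrDl.
Qed.

(** A vector u of the space with leading index j gives an ideal element whose largest word contains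
    x_j, because smaller indices are larger letters. *)
Lemma leading_x_word alpha n j beta : leading_index (ev_space alpha n beta) j ->
  ~ normal (x_word alpha n j beta).
Proof.
case/leading_indexP=> u [uU uj ui]; apply; exists (vec_poly u (prefix_word m alpha n) (nseq beta Gb)).
split; first exact: vec_poly_ideal.
split; first by rewrite vec_poly_at.
move=> w' /vec_poly_supp[i u_i ->].
rewrite /deglex_lt !size_cat /= eqxx lex_lt_cat lex_lt_GX lex_ltnn andbF orbF.
case: (ltngtP i j) => [/ui e|ji|/val_inj ->]; last by rewrite eqxx.
  by rewrite e eqxx in u_i.
by rewrite /= !orbT.
Qed.

Lemma mono_not_normal u q v : rel_A L R sigma (mono K q) -> ~ normal (u ++ q ++ v).
Proof.
move=> qA; apply; exists (mono K (u ++ q ++ v)); split.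
  by have := ideal_gen u v qA; rewrite !pmul_mono catA.
split=> [|w']; rewrite /mono; first by rewrite eqxx oner_eq0.
by have [_ //|_] := eqVneq w' (u ++ q ++ v); rewrite eqxx.
Qed.

Lemma xc_not_normal u i v : ~ normal (u ++ [:: GX i; Gc] ++ v).
Proof.
apply; eexists; split; first exact: (ideal_gen u v (rel_xc L R sigma i)).
rewrite xc_sum pmul_sandwich; split.
  rewrite (bigD1 None) //= big1 ?addr0 ?mul1r /mono ?eqxx ?oner_eq0 // => -[j|] // _.
  by rewrite eqseq_cat // eqxx /= mulr0.
move=> w' h; apply: contrapT => H; case/eqP: h; rewrite big1 // => o _.
rewrite /mono; case: eqP => [e|]; last by rewrite mulr0.
case: H; rewrite e; case: o {e} => [j|]; last by rewrite eqxx.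
by rewrite /deglex_lt !size_cat /= ltnn eqxx lex_lt_cat /= orbT.
Qed.

(** The letter on which the run dies forms with its predecessor one of the factors b y, y a, x_j x_i
    or x_j c, each the leading word of a relation. *)
Lemma nf_run_None w : nf_run w = None -> ~ normal w.
Proof.
move=> wN.
have [u [q [v [-> [qA|[i ->]]]]]] : exists u q v, w = u ++ q ++ v /\
    (rel_A L R sigma (mono K q) \/ exists i, q = [:: GX i; Gc]).
- elim/last_ind: w wN => [|w y IH] //.
  rewrite /nf_run foldl_rcons -/(nf_run w).
  have two w0 z : w = w0 ++ [:: z] -> rcons w y = w0 ++ [:: z; y] ++ [::].
    by move=> ->; rewrite -cats1 -catA.
  case E : (nf_run w) => [[[[a n] o] beta]|]; last first.
    have [u [q [v [-> H]]]] := IH E; exists u, q, (rcons v y); split=> //.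
    by rewrite !rcons_cat.
  case: beta E => E.
    have [w0 ew] : exists w0, w = w0 ++ [:: Gb].
      case: o E => [j /nf_run_x|/run_no_x] ->; last by eexists.
      by exists (prefix_word m a n ++ [:: GX j]); rewrite -catA.
    by exists w0, [:: Gb; y], [::]; split; [exact: two|left; constructor].
  case: y two => [i|||] two //=.
  + case: o E => [j|] // E _; exists (prefix_word m a n), [:: GX j; GX i], [::].
    by split; [apply: two; exact: (nf_run_x E)|left; constructor].
  + case/lastP: w E two {IH} => [[<- <- <-]|w0 z _ two _] //.
    exists w0, [:: z; Ga], [::]; split; last by left; constructor.
    by apply: two; rewrite cats1.
  case: o E => [j|] // E _; exists (prefix_word m a n), [:: GX j; Gc], [::].
  by split; [apply: two; exact: (nf_run_x E)|right; exists j].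
- exact: mono_not_normal.
exact: xc_not_normal.
Qed.

Lemma normal_wordP w : normal w <->
  match nf_run w with
  | Some (alpha, n, Some j, beta) => ~~ leading_index (ev_space alpha n beta) j
  | Some _ => true
  | None => false
  end.
Proof.
case E : (nf_run w) => [[[[alpha n] [j|]] beta]|].
- rewrite (nf_run_x E); split; first by move=> nw; apply/negP => /leading_x_word; apply.
  by move=> /negP H; apply: contrapT => /x_word_leading.
- by rewrite (run_no_x E); split=> // _; exact: no_x_normal.
by split=> // /(nf_run_None E).
Qed.
End Normal.

(** * The finite automaton *)

Lemma eventually_periodic_counter (I : finType) (P : I -> nat -> bool) :
  (forall i, eventually_periodic (P i)) ->
  exists (M : nat) (next : 'I_M.+1 -> 'I_M.+1) (Q : I -> 'I_M.+1 -> bool),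
    (forall n, (iter n next ord0 == ord0) = (n == 0%N)) /\
    (forall i n, P i n = Q i (iter n next ord0)).
Proof.
(* The preperiod is taken positive so that the counter never returns to 0, the value that decides
   whether a may be read. *)
move=> /eventually_periodic_family[N N0 [n1 H1]]; pose n0 := n1.+1.
have {}H i n : (n0 <= n)%N -> P i (n + N)%N = P i n by move=> nn; apply: H1; exact: ltnW.
have n00 : (0 < n0)%N by [].
move: n0 H n00 => n0 H n00 {n1 H1}.
(* The counter climbs from 0 to n0 + N - 1 and then jumps back to n0. *)
exists (n0 + N).-1, (fun k => if (k.+1 < n0 + N)%N then inord k.+1 else inord n0).
exists (fun i k => P i k).
have M1 : (n0 + N).-1.+1 = (n0 + N)%N by rewrite prednK // addn_gt0 N0 orbT.
split=> [[|n]|i n]; first by rewrite !eqxx.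
  rewrite iterS; move: (iter n _ _) => c; apply/negbTE; rewrite -val_eqE /=.
  by case: ifP => cN; rewrite inordK; lia.
set next := fun _ => _.
(* Here k counts the completed laps; after at least one lap the counter is in the periodic range. *)
have [k en kn] : exists2 k, n = (iter n next ord0 + k * N)%N & ((0 < k)%N -> (n0 <= iter n next ord0)%N).
  elim: n => [|n [k en kn]]; first by exists 0%N.
  rewrite iterS; move: (iter n next ord0) en kn => c en kn; rewrite {}en /next.
  have cM : (c < n0 + N)%N by apply: leq_trans (ltn_ord c) _; rewrite M1.
  case: ltnP => cN.
    have -> : nat_of_ord (@inord (n0 + N).-1 c.+1) = c.+1 by rewrite inordK //; lia.
    by exists k => // /kn; lia.
  have -> : nat_of_ord (@inord (n0 + N).-1 n0) = n0 by rewrite inordK //; lia.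
  by exists k.+1 => //; lia.
rewrite {1}en; case: k kn {en} => [|k] kn; first by rewrite addn0.
have {kn} := kn isT; move: (nat_of_ord _) => c nc; elim: (k.+1) => [|l IH]; first by rewrite addn0.
by rewrite mulSn addnCA addnC H ?IH // (leq_trans nc) ?leq_addr.
Qed.

Definition counter_step m M (next : 'I_M.+1 -> 'I_M.+1)
    (s : option (bool * 'I_M.+1 * option 'I_m * bool)) (y : gen m) :=
  match s with
  | Some (alpha, k, None, false) =>
      match y with
      | Ga => if ~~ alpha && (k == ord0) then Some (true, ord0, None, false) else None
      | Gb => Some (alpha, k, None, true)
      | Gc => Some (alpha, next k, None, false)
      | GX i => Some (alpha, k, Some i, false)
      end
  | Some (alpha, k, Some j, false) =>
      if y is Gb then Some (alpha, k, Some j, true) else None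
  | _ => None
  end.

Lemma counter_run m M (next : 'I_M.+1 -> 'I_M.+1) :
  (forall n, (iter n next ord0 == ord0) = (n == 0%N)) ->
  forall w : word m,
    foldl (counter_step next) (Some (false, ord0, None, false)) w =
    omap (fun t => let: (alpha, n, o, beta) := t in (alpha, iter n next ord0, o, beta)) (nf_run w).
Proof.
move=> next0; elim/last_ind => [|w y IH] //.
rewrite /nf_run !foldl_rcons IH -/(nf_run w).
case: (nf_run w) => [[[[alpha n] [j|]] [|]]|] //=; case: y => //=.
- by case: alpha n => [] [].
- by rewrite next0; case: alpha n => [] [].
Qed.

Theorem theorem4p5 (K : fieldType) (m : nat) (L R sigma : 'M[K]_m) :
  [pchar K] =i pred0 -> (0 < m)%N ->
  regular_language (normal_word L R sigma).
Proof.
move=> K0 _.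
pose P (i : bool * bool * 'I_m) n := leading_index (ev_space L R sigma i.1.1 n i.1.2) i.2.
have PP i : eventually_periodic (P i).
  (* R and the tail form the part that is constant in n, so [leading_index] becomes a membership in
     L sigma^n + G. *)
  have [N N0 [n0 H]] := eventually_periodic_submx sigma (if i.1.1 then L else 0)
    ((if i.1.2 then R else 0) + tail_mx K i.2)%MS (delta_mx 0 i.2 : 'rV_m) K0.
  exists N => //; exists n0 => n /H.
  by rewrite /P /leading_index /ev_space !addsmxA.
have [M [next [Q [next0 PQ]]]] := eventually_periodic_counter PP.
exists (option (bool * 'I_M.+1 * option 'I_m * bool)), (Some (false, ord0, None, false)).
exists (counter_step next).
exists (fun s => match s with
  | Some (alpha, k, Some j, beta) => ~~ Q (alpha, beta, j) k
  | Some _ => true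
  | None => false
  end) => w.
rewrite counter_run // normal_wordP unfold_in.
case: (nf_run w) => [[[[alpha n] [j|]] beta]|] //=.
by rewrite -PQ.
Qed.
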